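(* Let $G=(V,E,w)$ be a finite undirected loopless graph with vertex set $V=\{1,\dots,n\}$ and nonnegative edge weights $w_e\ge 0$ ($e\in E$). Let $0\le k\le n$ and $-1\le\vartheta\le 1$. Let $A_k$ and $D_k$ be the weighted adjacency and degree matrices of the $k$-token graph $F_k(G)$, put $H_k^{(\vartheta)}=A_k+\vartheta D_k$, let $\Pi_k$ be the orthogonal projection onto the eigenspace of $H_k^{(\vartheta)}$ for its largest eigenvalue (the top eigenspace), and let $\mathbf 1_k$ be the all-ones vector indexed by the $k$-subsets of $V$. Then the polynomial $$\sum_{S\subseteq V,\ |S|=k}(\Pi_k\mathbf 1_k)_S\, z^S,\qquad z^S=\prod_{i\in S}z_i,$$ in the variables $z_1,\dots,z_n$ is nonzero and Lorentzian. If the top eigenspace is one-dimensional, then for an entrywise nonnegative eigenvector $q$ spanning it (a Perron eigenvector, unique up to positive scaling), the polynomial $\sum_{|S|=k}q_S z^S$ is Lorentzian.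
   Context: Edges of $G$ are two-element subsets $\{i,j\}$ of $V$. No connectedness is assumed, and zero weights are allowed. For $0\le k\le n$, the weighted $k$-token graph $F_k(G)$ has vertex set $\binom{V}{k}=\{S\subseteq V:|S|=k\}$. Its weighted adjacency matrix $A_k$, indexed by $\binom Vk$, has entries $(A_k)_{S,T}=w_{\{i,j\}}$ if the symmetric difference $S\triangle T=\{i,j\}$ is an edge in $E$, and $(A_k)_{S,T}=0$ otherwise. Its weighted degree matrix is $D_k=\operatorname{diag}(d_k(S):S\in\binom Vk)$ with $d_k(S)=\sum_{e\in E,\ |S\cap e|=1}w_e$. For $k=0$ and $k=n$ these are the $1\times1$ zero matrices. Lorentzian polynomials (in the sense of Brändén and Huh): a homogeneous polynomial $f$ of degree $d$ in $N$ variables with nonnegative real coefficients is Lorentzian if (i) its support $J\subseteq\mathbb{N}^N$ (the set of exponents of monomials with nonzero coefficient) is M-convex, meaning that for all $\alpha,\beta\in J$ and every index $i$ with $\alpha_i>\beta_i$ there is an index $j$ with $\alpha_j<\beta_j$ and $\alpha-e_i+e_j\in J$ ($e_i$ the standard unit vectors); and (ii) if $d\ge2$, for every sequence of indices $i_1,\dots,i_{d-2}$ the Hessian matrix of the quadratic form $\partial_{i_1}\cdots\partial_{i_{d-2}}f$ has at most one positive eigenvalue (counted with multiplicity). *)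

(* Defs.v *)
From HB Require Import structures.
From mathcomp Require Import all_boot all_order all_algebra.
From mathcomp Require Import polyrcf.
From mathcomp Require Import mpoly.

Set Implicit Arguments.
Unset Strict Implicit.
Unset Printing Implicit Defensive.

Import Order.TTheory GRing.Theory Num.Theory.

Local Open Scope ring_scope.

Section Spectrum.
Variables (R : rcfType) (N : nat).
Implicit Types (M U : 'M[R]_N).

(* [rootsR p] is the strictly increasing list of the distinct roots of [p] in
   [R]; a real symmetric matrix has all its eigenvalues in [R], so for such
   matrices the two definitions below see the whole spectrum. *)
Definition num_pos_eigenvalues M : nat :=
  (\sum_(a <- rootsR (char_poly M) | (0 < a)%R) mup a (char_poly M))%N.

(* The default value 0 is only reached when [M] has no eigenvalue in [R]. *)
Definition top_eigenvalue M : R := last 0 (rootsR (char_poly M)).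

(* Vectors are row vectors and subspaces are row spaces, with matrices acting
   on the right; for the symmetric matrices considered here this agrees with
   the column convention. *)
Definition top_eigenspace M : 'M[R]_N := eigenspace M (top_eigenvalue M).

(* [kermx U^T] is the orthogonal complement of the row space of [U] for the
   standard inner product. *)
Definition orth_proj U : 'M[R]_N := proj_mx U (kermx U^T).

End Spectrum.

Section Lorentzian.
Variables (R : rcfType) (N : nat).
Implicit Types (f : {mpoly R[N]}).

(* The multi-index subtraction is truncated, but [b i < a i] makes it exact. *)
Definition M_convex (J : {pred 'X_{1..N}}) : Prop :=
  forall a b : 'X_{1..N}, a \in J -> b \in J ->
  forall i : 'I_N, (b i < a i)%N ->
  exists2 j : 'I_N, (a j < b j)%N & (a - U_(i) + U_(j))%MM \in J.

Definition iter_deriv (s : seq 'I_N) f : {mpoly R[N]} :=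
  foldr (fun i g => g^`M(i)) f s.

(* The second derivatives of a quadratic form are constant polynomials, given
   by their coefficients at the trivial monomial. *)
Definition quad_hessian f : 'M[R]_N :=
  \matrix_(i, j) (f^`M(i)^`M(j))@_0%MM.

Definition lorentzian (d : nat) f : Prop :=
  [/\ f \is d.-homog,
      forall m : 'X_{1..N}, 0 <= f@_m,
      M_convex (mem (msupp f)) &
      (2 <= d)%N -> forall s : (d - 2).-tuple 'I_N,
        (num_pos_eigenvalues (quad_hessian (iter_deriv s f)) <= 1)%N].

End Lorentzian.

Section TokenGraph.
Variables (R : rcfType) (n : nat).

Definition ksubsets (k : nat) : {set {set 'I_n}} := [set S : {set 'I_n} | #|S| == k].

(* Vectors and matrices indexed by the k-subsets are indexed by
   ['I_#|ksubsets k|], the subset of index [a] being [enum_val a]. *)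
Definition ksub (k : nat) (a : 'I_#|ksubsets k|) : {set 'I_n} := enum_val a.

Variables (E : {set {set 'I_n}}) (w : {set 'I_n} -> R).

Definition symdiff (S T : {set 'I_n}) : {set 'I_n} := (S :\: T) :|: (T :\: S).

Definition token_adj k : 'M[R]_#|ksubsets k| :=
  \matrix_(a, b)
    let e := symdiff (ksub a) (ksub b) in if e \in E then w e else 0.

Definition token_deg k : 'M[R]_#|ksubsets k| :=
  diag_mx (\row_a \sum_(e in E | #|ksub a :&: e| == 1%N) w e).

Definition token_H k (theta : R) : 'M[R]_#|ksubsets k| :=
  token_adj k + theta *: token_deg k.

End TokenGraph.

Definition ksubset_poly (R : rcfType) (n k : nat)
    (x : 'rV[R]_#|ksubsets n k|) : {mpoly R[n]} :=
  \sum_a x 0 a *: \prod_(i in ksub a) 'X_i.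

Definition perron_spans (R : rcfType) (N : nat) (U : 'M[R]_N) (q : 'rV[R]_N) :
    Prop :=
  (q == U)%MS /\ forall a, 0 <= q 0 a.

(* Main.v *)
(** Write [H = sum_e w_e H_e] over the edges.  For small [eps >= 0] the operator
    [1 + eps w_e H_e] replaces the part [z_i f + z_j g] of a multiaffine
    polynomial by [z_i (al f + be g) + z_j (al g + be f)], where
    [al = 1 + theta eps w_e] and [be = eps w_e]; the hypothesis on [theta] says
    exactly that [|al - be| <= 1 <= al + be].  Under this condition the operator
    preserves the multiaffine polynomials with positive coefficients all of whose
    second derivatives have at most one positive eigenvalue: up to a linear
    change of variables, a second derivative changes by a negative semidefinite
    form in [(z_i, z_j)].  Starting from the elementary symmetric polynomial,
    [q^3] normalized sweeps over the edges with [eps = q^-2] converge to the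
    projection of the all-ones vector on the top eigenspace.

    The eigenvalue condition is closed.  Closedness of M-convexity comes from the
    inequality [f f_ij <= 2 f_i f_j], valid for all derivatives of the
    approximating polynomials on the open positive orthant; it passes to the
    limit and forces the exchange property of the support. *)

Require Import Defs.
From mathcomp Require Import all_boot all_order all_algebra.
From mathcomp Require Import reals.
From mathcomp Require Import -(notations) mpoly.
From mathcomp Require Import spectral complex polyrcf.
From mathcomp Require Import boolp interval_inference filter topology normedtype.
From mathcomp Require Import sequences ring lra.

Import Order.TTheory GRing.Theory Num.Theory.
Import numFieldNormedType.Exports.
Local Open Scope ring_scope.

Set Implicit Arguments.
Unset Strict Implicit.
Unset Printing Implicit Defensive.

(** * Real symmetric matrices *)

(** Products of first-order factors replace the exponential of [t H]. One sweep differs from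
    [1 + eps H] by order [eps^2], so [m] sweeps accumulate an error of order [m eps^2], while the
    components below the top eigenvalue decay at a rate governed by [m eps]. With [eps = q^-2] and
    [m = q^3] these quantities are [1/q] and [q], and Bernoulli-type inequalities are enough to
    conclude. The preserved class has strictly positive coefficients because the passage from
    quadratic derivatives to derivatives of larger degree is a Perron argument, which wants a
    Hessian positive off the diagonal. A limit may lose coefficients, so everything that relies on
    positivity is first turned into polynomial inequalities, and only these are passed to the limit.
    The delicate case of an edge step is the derivative along a set containing exactly one endpoint.
    The Hessian is then no longer obtained by mixing two variables; it comes from a directional
    derivative of a cubic, and the Perron argument is called for again. *)

Section Spectral.
Variable R : rcfType.

Definition dotv n (x y : 'rV[R]_n) : R := \sum_i x 0 i * y 0 i.

Lemma mx11_dotv n (x y : 'rV[R]_n) : x *m y^T = (dotv x y)%:M.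
Proof.
apply/matrixP=> i j; rewrite !ord1 !mxE eqxx mulr1n.
by apply: eq_bigr => k _; rewrite mxE.
Qed.

Lemma dotv_ge0 n (x : 'rV[R]_n) : 0 <= dotv x x.
Proof. by apply: sumr_ge0 => i _; rewrite -expr2 sqr_ge0. Qed.

Lemma dotv_eq0 n (x : 'rV[R]_n) : (dotv x x == 0) = (x == 0).
Proof.
apply/eqP/eqP => [|->]; last by rewrite /dotv big1 // => i _; rewrite mxE mul0r.
move/eqP; rewrite psumr_eq0 => [/allP x0|i _]; last by rewrite -expr2 sqr_ge0.
apply/rowP => i; rewrite mxE; apply/eqP.
by have := x0 i (mem_index_enum _); rewrite mulf_eq0 orbb.
Qed.

Lemma dotv_gt0 n (x : 'rV[R]_n) : x != 0 -> 0 < dotv x x.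
Proof. by move=> x0; rewrite lt_def dotv_eq0 x0 dotv_ge0. Qed.

Lemma dotvC n (x y : 'rV[R]_n) : dotv x y = dotv y x.
Proof. by apply: eq_bigr => i _; rewrite mulrC. Qed.

Lemma dotvDl n (x y z : 'rV[R]_n) : dotv (x + y) z = dotv x z + dotv y z.
Proof. by rewrite -big_split; apply: eq_bigr => i _; rewrite mxE mulrDl. Qed.

Lemma dotvZl n a (x z : 'rV[R]_n) : dotv (a *: x) z = a * dotv x z.
Proof. by rewrite mulr_sumr; apply: eq_bigr => i _; rewrite mxE mulrA. Qed.

Lemma dotvDr n (x y z : 'rV[R]_n) : dotv z (x + y) = dotv z x + dotv z y.
Proof. by rewrite dotvC dotvDl !(dotvC z). Qed.

Lemma dotvZr n a (x z : 'rV[R]_n) : dotv z (a *: x) = a * dotv z x.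
Proof. by rewrite dotvC dotvZl dotvC. Qed.

Lemma dotv_mulmx n m (x : 'rV[R]_n) (M : 'M_(n, m)) y :
  dotv (x *m M) y = dotv x (y *m M^T).
Proof.
have e (a b : R) : a%:M = b%:M :> 'M_1 -> a = b.
  by move=> /matrixP /(_ 0 0); rewrite !mxE !mulr1n.
by apply: e; rewrite -!mx11_dotv trmx_mul trmxK mulmxA.
Qed.

(** Over the algebraically closed field [R[i]] an eigenvalue [a] exists. Evaluating [v M v^*] in two
    ways shows that [a] is its own conjugate, so its real part is a root of the characteristic
    polynomial over [R]. *)
Lemma sym_eigenvector n (M : 'M[R]_n) : (0 < n)%N -> M^T = M ->
  exists r, exists2 u : 'rV_n, u != 0 & u *m M = r *: u.
Proof.
move=> n0 Msym; pose C : numClosedFieldType := R[i].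
pose f : {rmorphism R -> C} := real_complex R.
pose M' : 'M[C]_n := map_mx f M.
have [a /eigenvalueP[v va v0]] := eigenvalue_closed M' n0.
have M'h : (M' ^t*)%sesqui = M'.
  apply/matrixP => i j; rewrite !mxE -[in RHS]Msym mxE.
  exact: conjc_real.
pose nv := (v *m (v ^t*)%sesqui) 0 0.
have nvE : nv = \sum_i `|v 0 i| ^+ 2.
  by rewrite /nv mxE; apply: eq_bigr => i _; rewrite !mxE normCK.
have nv0 : nv != 0.
  apply: contra_neq v0; rewrite nvE => /eqP; rewrite psumr_eq0 => [/allP h|i _].
    apply/rowP => i; rewrite mxE; apply/eqP.
    by have := h i (mem_index_enum _); rewrite expf_eq0 normr_eq0.
  exact: exprn_ge0.
have aR : a^* = a.
  apply: (mulIf nv0).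
  have e1 : v *m M' *m (v ^t*)%sesqui = a *: (v *m (v ^t*)%sesqui).
    by rewrite va scalemxAl.
  have e2 : v *m M' *m (v ^t*)%sesqui = a^* *: (v *m (v ^t*)%sesqui).
    rewrite -mulmxA -{1}M'h.
    have -> : (M' ^t* *m v ^t*)%sesqui = ((v *m M') ^t*)%sesqui.
      by rewrite trmx_mul map_mxM.
    rewrite va; apply/matrixP => i j; rewrite !mxE mulr_sumr.
    by apply: eq_bigr => l _; rewrite !mxE rmorphM /=; ring.
  have /matrixP/(_ 0 0) := etrans (esym e2) e1.
  by rewrite [LHS]mxE [RHS]mxE.
have aE : a = f (complex.Re a).
  by move: aR; case: (a) => x y [] /eqP; rewrite -subr_eq0 -opprD oppr_eq0 -mulr2n mulrn_eq0 /= => /eqP ->.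
have : root (char_poly M) (complex.Re a).
  rewrite -(fmorph_root f) map_char_poly -aE -eigenvalue_root_char.
  by apply/eigenvalueP; exists v.
rewrite -eigenvalue_root_char => /eigenvalueP[u ur u0].
by exists (complex.Re a), u.
Qed.

(* Householder reflection exchanging [u] and the first basis vector. *)
Lemma orthogonal_completion n (u : 'rV[R]_(1 + n)) : dotv u u = 1 ->
  exists Q : 'M[R]_(1 + n), [/\ Q^T = Q, Q *m Q = 1%:M & delta_mx 0 0 *m Q = u].
Proof.
move=> u1; pose e : 'rV[R]_(1 + n) := delta_mx 0 0.
have e1 : dotv e e = 1.
  rewrite /dotv (bigD1 0) //= big1 ?addr0 => [|i i0]; rewrite !mxE !eqxx ?mulr1 //.
  by rewrite (negPf i0) mul0r.
have [ue|ue] := eqVneq u e.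
  by exists 1%:M; rewrite trmx1 mulmx1 mulmx1 ue.
pose v := u - e; have v0 : v != 0 by rewrite subr_eq0.
have vv := dotv_gt0 v0; pose c := 2 / dotv v v.
have vvE : dotv v v = 2 - 2 * dotv e u.
  rewrite /v -[- e]scaleN1r !(dotvDl, dotvDr, dotvZl, dotvZr) u1 e1 (dotvC u e).
  by ring.
have ev : dotv e v = - dotv v v / 2.
  by rewrite vvE /v -[- e]scaleN1r !(dotvDr, dotvZr) e1; field.
exists (1%:M - c *: (v^T *m v)); split.
- by rewrite linearB /= trmx1 linearZ /= trmx_mul trmxK.
- rewrite mulmxBr mulmx1 mulmxBl mul1mx -scalemxAl -scalemxAr scalerA.
  rewrite mulmxA -(mulmxA v^T) mx11_dotv mul_mx_scalar -scalemxAl scalerA.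
  have -> : c * c * dotv v v = c + c by rewrite /c; field; rewrite lt0r_neq0.
  by rewrite scalerDl; apply/matrixP => i j; rewrite !mxE; ring.
- rewrite mulmxBr mulmx1 -scalemxAr mulmxA mx11_dotv mul_scalar_mx scalerA ev.
  have -> : c * (- dotv v v / 2) = -1 by rewrite /c; field; rewrite lt0r_neq0.
  by rewrite scaleN1r opprK addrC subrK.
Qed.

(** Deflation: conjugating by the reflection that sends the first basis vector to a unit eigenvector
    clears the first row, hence by symmetry the first column, and the induction applies to the
    remaining block. *)
Lemma real_spectral n (M : 'M[R]_n) : M^T = M ->
  exists P : 'M[R]_n, exists d : 'rV[R]_n,
    P *m P^T = 1%:M /\ M = P^T *m diag_mx d *m P.
Proof.
elim: n M => [|n IH] M Msym.
  by exists 1%:M, 0; split; apply/matrixP => [[]].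
move: M Msym; rewrite -[n.+1]/(1 + n)%N => M Msym.
have [r [u u0 ur]] := sym_eigenvector (ltn0Sn n) Msym.
pose t := Num.sqrt (dotv u u); have t0 : 0 < t by rewrite sqrtr_gt0 dotv_gt0.
pose u' : 'rV[R]_(1 + n) := t^-1 *: u.
have u'1 : dotv u' u' = 1.
  rewrite dotvZl dotvZr mulrA -invfM -expr2 sqr_sqrtr ?dotv_ge0 //.
  by rewrite mulVf // gt_eqF ?dotv_gt0.
have u'r : u' *m M = r *: u' by rewrite -scalemxAl ur !scalerA mulrC.
have [Q [Qsym QQ Qe]] := orthogonal_completion u'1.
have [N NQ] : exists N : 'M[R]_(1 + n), N = Q *m M *m Q by exists (Q *m M *m Q).
have Nsym : N^T = N by rewrite NQ !trmx_mul Qsym Msym mulmxA.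
have Ne : (delta_mx 0 0 : 'rV_(1 + n)) *m N = r *: delta_mx 0 0.
  by rewrite NQ !mulmxA Qe u'r -scalemxAl -Qe -mulmxA QQ mulmx1.
have N0 j : N 0 j = if j == 0 then r else 0.
  have := congr1 (fun A : 'rV_(1 + n) => A 0 j) Ne.
  by rewrite -rowE !mxE eqxx /= => ->; case: eqP; rewrite ?mulr1 ?mulr0.
have N0' (i j : 'I_(1 + n)) : val i = 0%N -> N i j = if val j == 0%N then r else 0.
  by move=> i0; rewrite (_ : i = 0) ?N0 //; apply: val_inj.
have NE : N = block_mx r%:M 0 0 (drsubmx N).
  rewrite -[LHS]submxK; congr block_mx; apply/matrixP => i j; rewrite !mxE.
  - by rewrite !ord1 N0' //= eqxx.
  - by rewrite N0' //= ord1.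
  - by rewrite -Nsym mxE N0' //= ord1.
have [P [d [PP Md]]] : exists P : 'M[R]_n, exists d : 'rV[R]_n,
    P *m P^T = 1%:M /\ drsubmx N = P^T *m diag_mx d *m P.
  by apply: IH; rewrite -[in RHS]Nsym; apply/matrixP => i j; rewrite !mxE.
exists (block_mx 1%:M 0 0 P *m Q), (row_mx r%:M d); split.
  rewrite trmx_mul Qsym mulmxA -(mulmxA _ Q Q) QQ mulmx1 tr_block_mx mulmx_block.
  by rewrite !trmx0 trmx1 !(mulmx0, mul0mx, addr0, add0r, mulmx1) PP -scalar_mx_block.
have -> : M = Q *m N *m Q by rewrite NQ !mulmxA QQ mul1mx -mulmxA QQ mulmx1.
rewrite trmx_mul Qsym -!mulmxA; congr (Q *m _); rewrite !mulmxA; congr (_ *m Q).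
rewrite NE Md diag_mx_row tr_block_mx !mulmx_block !trmx0 trmx1.
rewrite !(mulmx0, mul0mx, addr0, add0r, mulmx1, mul1mx).
by congr block_mx; apply/matrixP => i j; rewrite !ord1 !mxE eqxx.
Qed.

End Spectral.

Lemma sqr_gt0 (R : realDomainType) (x : R) : x != 0 -> 0 < x ^+ 2.
Proof. by move=> x0; rewrite lt_def sqrf_eq0 x0 sqr_ge0. Qed.

Lemma path_lt_last (R : realDomainType) (b x : R) s :
  path <%R b s -> x \in b :: s -> x <= last b s.
Proof.
elim: s b x => [|c s IH] b x /=; first by rewrite inE => _ /eqP->.
case/andP => bc cs; rewrite inE => /predU1P[->|]; last exact: IH.
by apply: le_trans (ltW bc) (IH _ _ cs _); rewrite inE eqxx.
Qed.

(** * Forms with at most one positive eigenvalue and the top eigenspace, in eigencoordinates *)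

Section Diagonalization.
Variables (R : rcfType) (n : nat).
Implicit Types (M P : 'M[R]_n) (d x y u v : 'rV[R]_n).

Definition bform M x y : R := dotv (x *m M) y.

Lemma bformDl M x y z : bform M (x + y) z = bform M x z + bform M y z.
Proof. by rewrite /bform mulmxDl dotvDl. Qed.
Lemma bformDr M x y z : bform M z (x + y) = bform M z x + bform M z y.
Proof. by rewrite /bform dotvDr. Qed.
Lemma bformZl M a x z : bform M (a *: x) z = a * bform M x z.
Proof. by rewrite /bform -scalemxAl dotvZl. Qed.
Lemma bformZr M a x z : bform M z (a *: x) = a * bform M z x.
Proof. by rewrite /bform dotvZr. Qed.

Lemma bformC M x y : M^T = M -> bform M x y = bform M y x.
Proof. by move=> Ms; rewrite /bform dotv_mulmx Ms dotvC. Qed.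

Lemma bformE M x y : bform M x y = \sum_i \sum_j M i j * x 0 i * y 0 j.
Proof.
rewrite exchange_big /bform /dotv; apply: eq_bigr => j _ /=.
rewrite mxE mulr_suml; apply: eq_bigr => i _; ring.
Qed.

(* For symmetric [M]: at most one positive eigenvalue. *)
Definition hyperbolic M : Prop :=
  forall x y, exists s t, (s != 0) || (t != 0) /\
    bform M (s *: x + t *: y) (s *: x + t *: y) <= 0.

(** The rows of [P] are orthonormal eigenvectors, and [x *m P^T] lists the coordinates of [x] in
    that basis. *)
Definition diagonalizes P d M : Prop :=
  P *m P^T = 1%:M /\ M = P^T *m diag_mx d *m P.

Lemma bform_diag P d M x y : diagonalizes P d M ->
  bform M x y = \sum_i d 0 i * (x *m P^T) 0 i * (y *m P^T) 0 i.
Proof.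
move=> [_ ->]; rewrite /bform !mulmxA dotv_mulmx /dotv; apply: eq_bigr => i _.
by rewrite mul_mx_diag mxE; ring.
Qed.

Lemma dotv_diag P d M x y : diagonalizes P d M ->
  dotv x y = \sum_i (x *m P^T) 0 i * (y *m P^T) 0 i.
Proof.
move=> [/mulmx1C PP _].
by rewrite -[LHS]/(dotv x y) -{1}(mulmx1 x) -PP mulmxA dotv_mulmx.
Qed.

Lemma row_diag P d M i : diagonalizes P d M -> row i P *m P^T = delta_mx 0 i.
Proof. by move=> [PP _]; rewrite rowE -mulmxA PP mulmx1. Qed.

Lemma row_eigen P d M i : diagonalizes P d M -> row i P *m M = d 0 i *: row i P.
Proof.
move=> PdM; rewrite {1}(proj2 PdM) !mulmxA (row_diag i PdM) -rowE row_diag_mx.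
by rewrite -scalemxAl -rowE.
Qed.

Lemma bform_rows P d M i j : diagonalizes P d M ->
  bform M (row i P) (row j P) = if i == j then d 0 i else 0.
Proof.
move=> PdM; rewrite (bform_diag _ _ PdM) !(row_diag _ PdM) (bigD1 i) //=.
rewrite big1 => [|l li]; rewrite !mxE !eqxx /=; last by rewrite (negPf li) mulr0 mul0r.
by case: eqP; rewrite /= ?mulr1 ?mulr0 addr0.
Qed.

Lemma char_poly_diag P d M : diagonalizes P d M ->
  char_poly M = \prod_(y <- [seq d 0 i | i <- enum 'I_n]) ('X - y%:P).
Proof.
move=> [PP ->]; rewrite big_map big_enum /=.
have PPC : (map_mx polyC P)^T *m map_mx polyC P = 1%:M.
  by rewrite map_trmx -map_mxM (mulmx1C PP) map_mx1.
rewrite /char_poly; have -> : char_poly_mx (P^T *m diag_mx d *m P) =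
    (map_mx polyC P)^T *m char_poly_mx (diag_mx d) *m map_mx polyC P.
  rewrite /char_poly_mx mulmxBr mulmxBl !map_mxM /= -map_trmx; congr (_ - _).
  by rewrite mul_mx_scalar -scalemxAl PPC scalemx1.
rewrite !det_mulmx mulrC mulrA -det_mulmx (mulmx1C PPC) det1 mul1r.
rewrite -[LHS]/(char_poly _) char_poly_trig ?diag_mx_is_trig //.
by apply: eq_bigr => i _; rewrite mxE eqxx.
Qed.

Lemma mem_rootsR_diag P d M a : diagonalizes P d M ->
  (a \in rootsR (char_poly M)) = (a \in [seq d 0 i | i <- enum 'I_n]).
Proof.
move=> PdM; rewrite -roots_on_rootsR ?monic_neq0 ?char_poly_monic //.
by rewrite in_itv /= (char_poly_diag PdM) root_prod_XsubC.
Qed.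

(** The multiplicity of a root is the number of indices carrying it. After exchanging the sums, each
    index counts at most once, since [rootsR] has no repetition, and only if its eigenvalue is
    positive. *)
Lemma num_pos_le P d M : diagonalizes P d M ->
  (num_pos_eigenvalues M <= #|[pred i | (0 < d 0 i)%R]|)%N.
Proof.
move=> PdM; rewrite /num_pos_eigenvalues (char_poly_diag PdM).
set s := [seq _ | _ <- _]; set r := rootsR _.
have ur : uniq r by exact: uniq_roots.
under eq_bigr do rewrite mu_prod_XsubC -sum1_count big_mkcond /=.
rewrite exchange_big /= big_map big_enum /= -sum1_card [leqRHS]big_mkcond /=.
apply: leq_sum => i _; rewrite inE.
have [di|di] := ltP 0 (d 0 i); last first.
  rewrite big1_seq // => a /andP[a0 _]; case: eqP => // e.
  by move: di; rewrite e leNgt a0.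
rewrite (@leq_trans (count_mem (d 0 i) r)) //; last by rewrite count_uniq_mem ?leq_b1.
rewrite -sum1_count big_mkcond [leqRHS]big_mkcond /=; apply: leq_sum => a _.
by rewrite eq_sym; case: ltP => // _; case: eqP.
Qed.

(** Two distinct rows with positive eigenvalues would span a plane on which the form is positive
    definite. *)
Lemma hyperbolic_diag P d M i j : diagonalizes P d M -> hyperbolic M ->
  0 < d 0 i -> 0 < d 0 j -> i = j.
Proof.
move=> PdM hM di dj; apply/eqP/negPn/negP => ij.
have [s [t [st]]] := hM (row i P) (row j P).
rewrite !(bformDl, bformDr, bformZl, bformZr) !(bform_rows _ _ PdM) !eqxx.
rewrite (negPf ij) eq_sym (negPf ij) !mulr0 addr0 add0r !mulrA -!expr2.
apply/negP; rewrite -ltNge; case/orP: st => h.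
  by apply: ltr_pwDl; [exact: mulr_gt0 (sqr_gt0 h) _|exact: mulr_ge0 (sqr_ge0 _) (ltW _)].
by apply: ltr_wpDl; [exact: mulr_ge0 (sqr_ge0 _) (ltW _)|exact: mulr_gt0 (sqr_gt0 h) _].
Qed.

Lemma hyperbolic_num_pos M : M^T = M -> hyperbolic M ->
  (num_pos_eigenvalues M <= 1)%N.
Proof.
move=> /real_spectral[P [d PdM]] hM; apply: leq_trans (num_pos_le PdM) _.
by apply/card_le1_eqP => i j; rewrite !inE => di dj; rewrite (hyperbolic_diag PdM hM di dj).
Qed.

(** Every plane meets the kernel of a linear functional, so it suffices to be nonpositive on one
    such kernel. *)
Lemma hyperbolic_functional M (l : 'rV[R]_n) :
  (forall y, dotv l y = 0 -> bform M y y <= 0) -> hyperbolic M.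
Proof.
move=> h x y; have [lx|lx] := eqVneq (dotv l x) 0.
  exists 1, 0; rewrite oner_eq0; split => //.
  by apply: h; rewrite dotvDr !dotvZr lx; ring.
exists (dotv l y), (- dotv l x); rewrite oppr_eq0 lx orbT; split => //.
by apply: h; rewrite dotvDr !dotvZr; ring.
Qed.

Lemma diag_hyperbolic P d M : diagonalizes P d M ->
  (forall i j, 0 < d 0 i -> 0 < d 0 j -> i = j) -> hyperbolic M.
Proof.
move=> PdM h; have [i0 di0|dn] := pickP [pred i | 0 < d 0 i]; last first.
  apply: (@hyperbolic_functional _ 0) => y _; rewrite (bform_diag _ _ PdM).
  apply: sumr_le0 => i _; rewrite -mulrA mulr_le0_ge0 -?expr2 ?sqr_ge0 //.
  by rewrite leNgt; have := dn i; rewrite /= => ->.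
apply: (@hyperbolic_functional _ (row i0 P)) => y.
rewrite (dotv_diag _ _ PdM) (row_diag _ PdM) (bigD1 i0) //= big1 ?addr0; last first.
  by move=> i ii0; rewrite mxE eqxx (negPf ii0) mul0r.
rewrite mxE !eqxx mul1r => y0.
rewrite (bform_diag _ _ PdM); apply: sumr_le0 => i _.
have [->|ii0] := eqVneq i i0; first by rewrite y0 mulr0.
rewrite -mulrA mulr_le0_ge0 -?expr2 ?sqr_ge0 // leNgt; apply: contraNN ii0 => di.
by rewrite (h i i0).
Qed.

(** Reversed Cauchy-Schwarz. The vector [y'] is a multiple of the component of [y] orthogonal to [x]
    for the form; as the form is positive at [x], hyperbolicity on the plane of [x] and [y'] makes
    it nonpositive at [y']. *)
Lemma hyperbolic_CS M x y : M^T = M -> hyperbolic M -> 0 <= bform M x x ->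
  bform M x x * bform M y y <= bform M x y ^+ 2.
Proof.
move=> Ms hM; rewrite le_eqVlt => /orP[/eqP<-|xx]; first by rewrite mul0r sqr_ge0.
have [y' y'E] : exists y', y' = bform M x x *: y + (- bform M x y) *: x by eexists.
have xy' : bform M x y' = 0 by rewrite y'E bformDr !bformZr; ring.
have yy' : bform M y' y' =
    bform M x x * (bform M x x * bform M y y - bform M x y ^+ 2).
  by rewrite y'E !(bformDl, bformDr, bformZl, bformZr) (bformC y x Ms); ring.
rewrite -subr_le0 -(pmulr_rle0 _ xx) -yy'.
have [s [t [st]]] := hM x y'.
rewrite !(bformDl, bformDr, bformZl, bformZr) (bformC y' x Ms) xy'.
rewrite !mulr0 addr0 add0r !mulrA -!expr2.
have [t0|t0] := eqVneq t 0.
  move: st; rewrite t0 eqxx orbF => s0.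
  by rewrite expr0n mul0r addr0 leNgt mulr_gt0 ?sqr_gt0.
move=> h; rewrite -(pmulr_rle0 (x := t ^+ 2)); last by rewrite sqr_gt0.
apply: le_trans h; rewrite lerDr mulr_ge0 ?sqr_ge0 // ltW //.
Qed.

Lemma le_top_eigenvalue P d M i : diagonalizes P d M -> d 0 i <= top_eigenvalue M.
Proof.
move=> PdM; have : d 0 i \in rootsR (char_poly M).
  by rewrite (mem_rootsR_diag _ PdM) map_f ?mem_enum.
rewrite /top_eigenvalue; have : sorted <%R (rootsR (char_poly M)) by apply: sorted_roots.
case: (rootsR _) => //= b s; exact: path_lt_last.
Qed.

Lemma ex_top_eigenvalue P d M : (0 < n)%N -> diagonalizes P d M ->
  exists i, d 0 i = top_eigenvalue M.
Proof.
move=> n0 PdM; have : top_eigenvalue M \in rootsR (char_poly M).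
  have : d 0 (Ordinal n0) \in rootsR (char_poly M).
    by rewrite (mem_rootsR_diag _ PdM) map_f ?mem_enum.
  by rewrite /top_eigenvalue; case: (rootsR _) => // b s _ /=; apply: mem_last.
by rewrite (mem_rootsR_diag _ PdM) => /mapP[i _ ->]; exists i.
Qed.

Lemma sub_top_eigenspace P d M x : diagonalizes P d M ->
  (x <= top_eigenspace M)%MS =
  [forall i, (d 0 i != top_eigenvalue M) ==> ((x *m P^T) 0 i == 0)].
Proof.
move=> PdM; rewrite /top_eigenspace; move: (top_eigenvalue M) => lam.
apply/eigenspaceP/forallP => [xM i|h].
  apply/implyP => di; have := congr1 (fun u => (u *m P^T) 0 i) xM.
  rewrite [in X in X -> _](proj2 PdM) !mulmxA -[_ *m P *m P^T]mulmxA (proj1 PdM) mulmx1.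
  rewrite mul_mx_diag mxE -scalemxAl [RHS]mxE mulrC => /eqP.
  by rewrite -subr_eq0 -mulrBl mulf_eq0 subr_eq0 (negPf di).
have xE : x = x *m P^T *m P by rewrite -mulmxA (mulmx1C (proj1 PdM)) mulmx1.
rewrite [in LHS](proj2 PdM) !mulmxA [in RHS]xE scalemxAl; congr (_ *m P).
apply/rowP => i; rewrite mul_mx_diag !mxE mulrC.
have := h i; case: eqVneq => [->//|_ /= /eqP]; rewrite !mxE => ->.
by rewrite !mulr0.
Qed.

(** [proj_mx] is controlled by a decomposition along two subspaces meeting trivially; here this is
    definiteness of the standard inner product. The kept coordinates give the part in the
    eigenspace, the others the part in its complement. *)
Lemma orth_proj_diag P d M x : diagonalizes P d M ->
  x *m orth_proj (top_eigenspace M) =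
  \row_i (if d 0 i == top_eigenvalue M then (x *m P^T) 0 i else 0) *m P.
Proof.
move=> PdM; set U := top_eigenspace M; set x1 := _ *m P.
have PP := proj1 PdM.
have x1P : x1 *m P^T = \row_i (if d 0 i == top_eigenvalue M then (x *m P^T) 0 i else 0).
  by rewrite /x1 -mulmxA PP mulmx1.
have x1U : (x1 <= U)%MS.
  rewrite (sub_top_eigenspace _ PdM) x1P; apply/forallP => i; apply/implyP => di.
  by rewrite mxE (negPf di).
have dxi : (U :&: kermx U^T = 0)%MS.
  apply/eqP; rewrite -submx0; apply/row_subP => i.
  have := row_sub i (U :&: kermx U^T)%MS; set z := row i _.
  rewrite sub_capmx => /andP[/submxP[w zU] /sub_kermxP zK].
  rewrite submx0 -dotv_eq0; apply/eqP; rewrite {2}zU dotvC dotv_mulmx dotvC.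
  by rewrite zK /dotv big1 // => j _; rewrite mxE mul0r.
have x2K : (x - x1 <= kermx U^T)%MS.
  apply/sub_kermxP; apply/rowP => i.
  have rU : (row i U <= U)%MS by exact: row_sub.
  rewrite [RHS]mxE.
  have -> : ((x - x1) *m U^T) 0 i = dotv (x - x1) (row i U).
    by rewrite mxE; apply: eq_bigr => j _; rewrite !mxE.
  rewrite (dotv_diag _ _ PdM) big1 // => j _; rewrite mulmxBl x1P.
  move: rU; rewrite (sub_top_eigenspace _ PdM) => /forallP/(_ j).
  move: (row i U *m P^T) (x *m P^T) => z v; rewrite !mxE.
  by case: eqVneq => [_ _|_ /= /eqP ->];
    rewrite ?subrr ?mul0r ?mulr0.
rewrite -{1}(subrK x1 x) mulmxDl /orth_proj proj_mx_0 // proj_mx_id //.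
by rewrite add0r.
Qed.

End Diagonalization.

(** * From derivatives to the Hessian *)

Section LocalToGlobal.
Variables (R : rcfType) (n : nat).
Implicit Types (M L : 'M[R]_n).

(** Since [hyperbolic] asks for nonzero coefficients rather than nonzero vectors, the pullback works
    for a singular [L] too. *)
Lemma hyperbolic_sub M M' L : hyperbolic M ->
  (forall y, bform M' y y <= bform M (y *m L) (y *m L)) -> hyperbolic M'.
Proof.
move=> hM h x y; have [s [t [st le0]]] := hM (x *m L) (y *m L).
exists s, t; split => //; apply: le_trans (h _) _.
by rewrite mulmxDl -!scalemxAl.
Qed.

(** The model is a homogeneous [f] in the variables of [A]: [M] is its Hessian at the all-ones
    point, [Q l] that of the derivative of [f] along [l], and [c] is the degree minus two. Then
    [sumQ] and [rowQ] are Euler identities. *)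
Variables (M : 'M[R]_n) (A : {set 'I_n}) (Q : 'I_n -> 'M[R]_n) (c : R).
Hypotheses (c_gt0 : 0 < c) (Msym : M^T = M) (Qsym : forall l, (Q l)^T = Q l).
Hypothesis M_out : forall i j, i \notin A -> M i j = 0.
Hypothesis M_ge0 : forall i j, 0 <= M i j.
Hypothesis M_gt0 : forall i j, i \in A -> j \in A -> i != j -> 0 < M i j.
Hypothesis row_gt0 : forall i, i \in A -> 0 < \sum_j M i j.
Hypothesis Qhyp : forall l, l \in A -> hyperbolic (Q l).
Hypothesis sumQ : forall i j, \sum_(l in A) Q l i j = c * M i j.
Hypothesis rowQ : forall l i, l \in A -> \sum_j Q l i j = c * M l i.

Let r i := \sum_j M i j.

Let r_ge0 i : 0 <= r i. Proof. exact: sumr_ge0. Qed.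

Let Mji i j : M j i = M i j. Proof. by rewrite -{1}Msym mxE. Qed.

Let bformQ1 l x : l \in A -> bform (Q l) x (const_mx 1) = c * (x *m M) 0 l.
Proof.
move=> lA; rewrite bformE mxE mulr_sumr; apply: eq_bigr => i _.
under eq_bigr do rewrite mxE mulr1 mulrC.
by rewrite -mulr_sumr rowQ // Mji; ring.
Qed.

Let bform_le_sum x : bform M x x <= \sum_(l in A) (x *m M) 0 l ^+ 2 / r l.
Proof.
rewrite -(ler_pM2l c_gt0).
have -> : c * bform M x x = \sum_(l in A) bform (Q l) x x.
  under eq_bigr do rewrite bformE; rewrite bformE mulr_sumr exchange_big /=.
  apply: eq_bigr => i _; rewrite mulr_sumr exchange_big /=.
  by apply: eq_bigr => j _; rewrite -!mulr_suml sumQ; ring.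
rewrite mulr_sumr; apply: ler_sum => l lA.
have Q11 : bform (Q l) (const_mx 1) (const_mx 1) = c * r l.
  rewrite bformQ1 //; congr (_ * _); rewrite mxE.
  by apply: eq_bigr => j _; rewrite mxE mul1r Mji.
have cr : 0 < c * r l by rewrite mulr_gt0 ?row_gt0.
have := @hyperbolic_CS _ _ _ (const_mx 1) x (Qsym l) (Qhyp lA).
rewrite Q11 (bformC (const_mx 1) x (Qsym l)) bformQ1 // => /(_ (ltW cr)) h.
rewrite -(ler_pM2l cr); apply: le_trans h _.
rewrite le_eqVlt; apply/orP; left; apply/eqP; field.
by rewrite gt_eqF ?row_gt0.
Qed.

Let s := diag_mx (\row_i Num.sqrt (r i)^-1).
Let t := diag_mx (\row_i Num.sqrt (r i)).

(** With [x = u s], the bound [bform_le_sum] gives [d <= d^2], so [d >= 1]. Conversely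
    [sum r x^2 - bform M x x] is half the Laplacian form [sum M_jl (x_j - x_l)^2], which is
    nonnegative; it must therefore vanish, and [x] is constant on [A]. *)
Let eigen_sqrt P d i : diagonalizes P d (s *m M *m s) -> 0 < d 0 i ->
  exists a, row i P = \row_l (a * Num.sqrt (r l)).
Proof.
move=> PdB di; set u := row i P; pose x := u *m s.
have xM l : (x *m M) 0 l * Num.sqrt (r l)^-1 = d 0 i * u 0 l.
  have := congr1 (fun v : 'rV_n => v 0 l) (row_eigen i PdB).
  by rewrite !mulmxA /s mul_mx_diag mxE -/s -/x [in RHS]mxE [in X in _ * X]mxE.
have r0 l : l \notin A -> r l = 0.
  by move=> lA; rewrite /r big1 // => j _; rewrite M_out.
have uA l : l \notin A -> u 0 l = 0.
  move=> lA; have /eqP := xM l; rewrite r0 // invr0 sqrtr0 mulr0 eq_sym.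
  by rewrite mulf_eq0 (gt_eqF di) => /eqP.
have xl l : x 0 l = u 0 l * Num.sqrt (r l)^-1.
  by rewrite /x /s mul_mx_diag mxE [in X in _ * X]mxE.
have ux l : u 0 l = x 0 l * Num.sqrt (r l).
  have [lA|lA] := boolP (l \in A); last by rewrite uA // r0 // sqrtr0 mulr0.
  by rewrite xl -mulrA -sqrtrM ?invr_ge0 // mulVf ?sqrtr1 ?mulr1 // gt_eqF ?row_gt0.
have uu : dotv u u = 1.
  rewrite (dotv_diag _ _ PdB) (row_diag _ PdB) (bigD1 i) //= big1 => [|j ji].
    by rewrite mxE !eqxx mulr1 addr0.
  by rewrite mxE (negPf ji) andbF mul0r.
have Mxx : bform M x x = d 0 i.
  have := bform_rows i i PdB; rewrite eqxx => <-.
  by rewrite /bform !mulmxA [RHS]dotv_mulmx /s tr_diag_mx.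
have d1 : 1 <= d 0 i.
  have := bform_le_sum x; rewrite Mxx.
  under eq_bigr => l lA.
    have -> : (x *m M) 0 l ^+ 2 / r l = d 0 i ^+ 2 * (u 0 l * u 0 l).
      rewrite -expr2 -exprMn -xM exprMn sqr_sqrtr ?invr_ge0 //.
    over.
  rewrite -mulr_sumr => h.
  have : d 0 i <= d 0 i ^+ 2 * 1.
    apply: le_trans h _; rewrite ler_wpM2l ?sqr_ge0 // -uu.
    by rewrite /dotv big_mkcond; apply: ler_sum => l _; case: ifP; rewrite // -expr2 sqr_ge0.
  by rewrite mulr1 expr2 ler_pMl.
have rx : \sum_l r l * x 0 l ^+ 2 <= bform M x x.
  rewrite Mxx; apply: le_trans d1; rewrite -uu; apply: ler_sum => l _.
  by rewrite ux -expr2 exprMn sqr_sqrtr // mulrC.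
have xx j l : M j l * (x 0 j - x 0 l) ^+ 2 = 0.
  have ge0 j' l' : 0 <= M j' l' * (x 0 j' - x 0 l') ^+ 2 by rewrite mulr_ge0 ?sqr_ge0.
  have le0 : \sum_j \sum_l M j l * (x 0 j - x 0 l) ^+ 2 <= 0.
    have -> : \sum_j \sum_l M j l * (x 0 j - x 0 l) ^+ 2 =
      \sum_l r l * x 0 l ^+ 2 *+ 2 - bform M x x *+ 2.
      rewrite bformE.
      transitivity (\sum_j \sum_l (M j l * x 0 j ^+ 2 + M j l * x 0 l ^+ 2
         - (M j l * x 0 j * x 0 l) *+ 2)).
        by apply: eq_bigr => j' _; apply: eq_bigr => l' _; ring.
      under eq_bigr do rewrite !big_split /= sumrN sumrMnl.
      rewrite !big_split /= sumrN sumrMnl; congr (_ - _).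
      rewrite [X in _ + X]exchange_big /=; congr (_ + _).
        by apply: eq_bigr => j' _; rewrite mulr_suml.
      apply: eq_bigr => j' _; rewrite mulr_suml; apply: eq_bigr => l' _.
      by rewrite Mji.
    by rewrite sumrMnl -mulrnBl pmulrn_lle0 // subr_le0.
  have := le_anti (introT andP (conj le0 (sumr_ge0 _ (fun j _ => sumr_ge0 _ (fun l _ => ge0 j l))))).
  move/eqP; rewrite psumr_eq0 => [/allP/(_ j)|j' _]; last exact: sumr_ge0.
  rewrite mem_index_enum => /(_ isT)/=; rewrite psumr_eq0 // => /allP/(_ l).
  by rewrite mem_index_enum => /(_ isT)/= /eqP.
have [l0 l0A|A0] := pickP (mem A); last first.
  by exists 0; apply/rowP => l; rewrite [RHS]mxE mul0r -[LHS]/(u 0 l) uA //= -[_ \in _]/(mem A l) A0.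
exists (x 0 l0); apply/rowP => l; rewrite [RHS]mxE -[LHS]/(u 0 l).
have [lA|lA] := boolP (l \in A); last by rewrite uA // r0 // sqrtr0 mulr0.
rewrite ux; have [->//|ll0] := eqVneq l l0; congr (_ * _).
have /eqP := xx l l0; rewrite mulf_eq0 gt_eqF ?M_gt0 //=.
by rewrite sqrf_eq0 subr_eq0 => /eqP.
Qed.

(* Cauchy-Schwarz for each [Q l] against the all-ones vector gives
   [M <= M D M] with [D = diag (1 / r)], so the symmetrization of [M] by
   [D^(1/2)] has no eigenvalue in the open interval from 0 to 1.  Its largest
   eigenvalue is 1, with eigenvector [sqrt r], and it is simple because [M] is
   positive off the diagonal of [A]. *)
Lemma local_to_global : hyperbolic M.
Proof.
have Bsym : (s *m M *m s)^T = s *m M *m s.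
  by rewrite !trmx_mul Msym /s tr_diag_mx mulmxA.
have [P [d PdB]] := real_spectral Bsym.
have hB : hyperbolic (s *m M *m s).
  apply: (diag_hyperbolic PdB) => i j di dj; apply/eqP/negPn/negP => ij.
  (* Both rows are multiples of [sqrt r]; orthogonality makes one of them vanish, against their unit
     norms. *)
  have [a ua] := eigen_sqrt PdB di; have [b ub] := eigen_sqrt PdB dj.
  have e (a' b' : R) : dotv (\row_l (a' * Num.sqrt (r l))) (\row_l (b' * Num.sqrt (r l)))
      = a' * b' * \sum_l r l.
    rewrite mulr_sumr; apply: eq_bigr => l _; rewrite !mxE.
    by rewrite -[in RHS](sqr_sqrtr (r_ge0 l)); ring.
  have dr i' j' : dotv (row i' P) (row j' P) = (i' == j')%:R.
    rewrite (dotv_diag _ _ PdB) !(row_diag _ PdB) (bigD1 i') //= big1 => [|l li].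
      by rewrite !mxE !eqxx mul1r addr0.
    by rewrite !mxE (negPf li) andbF mul0r.
  have := dr i i; have := dr j j; have := dr i j.
  rewrite ua ub !e !eqxx (negPf ij) => /eqP.
  rewrite !mulf_eq0 -orbA => /or3P[] /eqP->; rewrite ?mulr0 ?mul0r => h1 h2;
    by move/eqP: h1; move/eqP: h2; rewrite ?(eq_sym 0) ?oner_eq0.
apply: (hyperbolic_sub (L := t) hB) => y; rewrite le_eqVlt; apply/orP; left; apply/eqP.
(* As [r] vanishes off [A], [s] inverts [t] only on [A]; this undoes the symmetrization because [M]
   is supported on [A]. *)
have ts : t *m s = diag_mx (\row_i (i \in A)%:R).
  rewrite /t /s mulmx_diag; congr diag_mx; apply/rowP => i; rewrite !mxE.
  have [iA|iA] := boolP (i \in A); last first.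
    by rewrite (_ : r i = 0) ?sqrtr0 ?mul0r // /r big1 // => j _; rewrite M_out.
  by rewrite -sqrtrM // mulfV ?sqrtr1 // gt_eqF ?row_gt0.
have st : s *m t = diag_mx (\row_i (i \in A)%:R).
  by rewrite -ts /t /s diag_mxC.
have tT : t^T = t by rewrite /t tr_diag_mx.
rewrite /bform [RHS]dotvC [RHS]dotv_mulmx [RHS]dotvC tT !mulmxA.
congr dotv; rewrite -[y *m t *m s]mulmxA ts -[_ *m s *m t]mulmxA st.
apply/rowP => j; rewrite mul_mx_diag mxE [in RHS]mxE !mxE mulr_suml.
apply: eq_bigr => i _; rewrite mul_mx_diag !mxE.
have [iA|iA] := boolP (i \in A); last by rewrite M_out // !mulr0 mul0r.
have [jA|jA] := boolP (j \in A); last by rewrite -Mji M_out // !mulr0.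
by rewrite !mulr1.
Qed.

End LocalToGlobal.

(** * Hyperbolicity under limits, scalings and diagonal substitutions *)

Section HyperbolicExtra.
Variables (R : rcfType) (n : nat).
Implicit Types (M : 'M[R]_n).

Lemma bform1 M : bform M (const_mx 1) (const_mx 1) = \sum_i \sum_j M i j.
Proof.
by rewrite bformE; apply: eq_bigr => i _; apply: eq_bigr => j _; rewrite !mxE !mulr1.
Qed.

(* For nonnegative matrices the hypothesis, unlike [hyperbolic] itself, is a
   polynomial inequality, hence closed under limits. *)
Lemma hyperbolic_nonneg M : (forall i j, 0 <= M i j) ->
  (forall y, bform M (const_mx 1) (const_mx 1) * bform M y y <=
             bform M (const_mx 1) y ^+ 2) -> hyperbolic M.
Proof.
move=> M0 K; have [M1|M1] := ltP 0 (bform M (const_mx 1) (const_mx 1)).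
  apply: (@hyperbolic_functional _ _ _ (const_mx 1 *m M)) => y y0.
  by have := K y; rewrite /bform in M1 y0 *; rewrite y0 expr0n pmulr_rle0.
have M00 i j : M i j = 0.
  have : \sum_i \sum_j M i j == 0.
    by rewrite eq_le -bform1 M1 bform1; apply: sumr_ge0 => i' _; apply: sumr_ge0.
  rewrite psumr_eq0 => [/allP/(_ i)|i' _]; last exact: sumr_ge0.
  rewrite mem_index_enum => /(_ isT)/=; rewrite psumr_eq0 // => /allP/(_ j).
  by rewrite mem_index_enum => /(_ isT)/= /eqP.
apply: (@hyperbolic_functional _ _ _ 0) => y _.
by rewrite bformE big1 // => i _; rewrite big1 // => j _; rewrite M00 !mul0r.
Qed.

(** This plays the role of the limit [e -> 0] in an arbitrary real closed field, without
    topology. *)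
Lemma le0_of_small (a b c : R) :
  (forall e, 0 < e -> a + e * b + e ^+ 2 * c <= 0) -> a <= 0.
Proof.
move=> h; rewrite leNgt; apply/negP => a0.
pose D := 1 + `|b| + `|c|.
have D0 : 0 < D by rewrite /D -addrA ltr_pwDl ?ltr01 ?addr_ge0.
(* With [e <= 1] and [e (D + a) = a], the expression is at least [a - e (D - 1) = e (1 + a) > 0]. *)
pose e := a / (D + a); have Da : 0 < D + a by rewrite addr_gt0.
have e0 : 0 < e by rewrite divr_gt0.
have e1 : e <= 1 by rewrite ler_pdivrMr // mul1r lerDr ltW.
have := h e e0; apply/negP; rewrite -ltNge.
have h1 : - (e * `|b|) <= e * b by rewrite -mulrN ler_pM2l // lerNl ler_normr lexx orbT.
have h2 : - (e * `|c|) <= e ^+ 2 * c.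
  have : - (e ^+ 2 * `|c|) <= e ^+ 2 * c.
    by rewrite -mulrN ler_wpM2l ?sqr_ge0 // lerNl ler_normr lexx orbT.
  by apply: le_trans; rewrite lerN2 ler_wpM2r // expr2 ler_piMl // ltW.
have h3 : e * (D + a) = a by rewrite /e mulfVK // gt_eqF.
have : 0 < e * (1 + a) by rewrite mulr_gt0 // addr_gt0.
move: h3; rewrite /D; lra.
Qed.

(** Reversed Cauchy-Schwarz for [M + e M'] against the all-ones vector is a quadratic inequality in
    [e], whose constant term is the inequality wanted for [M]. *)
Lemma hyperbolic_lim M M' : M^T = M -> M'^T = M' ->
  (forall i j, 0 <= M i j) -> (forall i j, 0 <= M' i j) ->
  (forall e, 0 < e -> hyperbolic (M + e *: M')) -> hyperbolic M.
Proof.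
move=> Ms Ms' M0 M0' h; apply: hyperbolic_nonneg => // y; rewrite -subr_le0.
have lin e x z : bform (M + e *: M') x z = bform M x z + e * bform M' x z.
  by rewrite /bform mulmxDr dotvDl -scalemxAr dotvZl.
pose o : 'rV[R]_n := const_mx 1.
apply: (@le0_of_small _
  (bform M o o * bform M' y y + bform M' o o * bform M y y
    - 2 * bform M o y * bform M' o y)
  (bform M' o o * bform M' y y - bform M' o y ^+ 2)) => e e0.
have es : (M + e *: M')^T = M + e *: M' by rewrite linearD linearZ /= Ms Ms'.
have oo0 : 0 <= bform (M + e *: M') o o.
  rewrite lin addr_ge0 ?mulr_ge0 ?(ltW e0) // bform1;
  by apply: sumr_ge0 => i _; apply: sumr_ge0 => j _.
have := @hyperbolic_CS _ _ _ o y es (h e e0) oo0; rewrite !lin -subr_le0.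
apply: le_trans; rewrite le_eqVlt; apply/orP; left; apply/eqP.
by rewrite /o; ring.
Qed.

Lemma hyperbolic_scale M a : 0 < a -> hyperbolic M -> hyperbolic (a *: M).
Proof.
move=> a0 hM x y; have [s [t [st le0]]] := hM x y; exists s, t; split => //.
by rewrite /bform -scalemxAr dotvZl pmulr_rle0.
Qed.

(** The substitution of [w_i z_i] for [z_i]; zero weights, which erase a row and a column, are
    allowed. *)
Lemma hyperbolic_diag_congr M M' (w : 'I_n -> R) : hyperbolic M ->
  (forall i j, M' i j = M i j * w i * w j) -> hyperbolic M'.
Proof.
move=> hM M'E; apply: (hyperbolic_sub (L := diag_mx (\row_i w i)) hM) => y.
rewrite le_eqVlt; apply/orP; left; apply/eqP.
rewrite !bformE; apply: eq_bigr => i _; apply: eq_bigr => j _.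
by rewrite !mul_mx_diag !mxE M'E; ring.
Qed.

End HyperbolicExtra.

(** * Polynomials with positive coefficients *)

Section SetFunctions.
Variables (R : rcfType) (n k : nat).
Implicit Types (F : {set 'I_n} -> R) (S T : {set 'I_n}).

(* [psum F S] is the value at the all-ones point of the derivative along [S]
   of the polynomial with coefficients [F], and [hess F S] is the Hessian of
   that derivative at the same point. *)
Definition psum F S : R := \sum_(T : {set 'I_n} | (S \subset T) && (#|T| == k)) F T.

Definition hess F S : 'M[R]_n := \matrix_(i, j)
  if [&& i != j, i \notin S & j \notin S] then psum F (i |: (j |: S)) else 0.

Lemma hess_sym F S : (hess F S)^T = hess F S.
Proof. by apply/matrixP => i j; rewrite !mxE eq_sym setUCA andbA andbAC -andbA. Qed.

Lemma psum_card F S : #|S| = k -> psum F S = F S.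
Proof.
move=> Sk; rewrite /psum (bigD1 S) ?subxx ?Sk //= big1 ?addr0 // => T.
by case/andP => /andP[ST /eqP Tk] /eqP[]; apply/esym/eqP; rewrite eqEcard ST Tk Sk /=.
Qed.

(** Euler's identity for the derivative along [S]: each [T] containing [S] is counted once for every
    element of [T :\: S]. *)
Lemma psum_euler F S :
  \sum_(l in ~: S) psum F (l |: S) = (k - #|S|)%:R * psum F S.
Proof.
rewrite /psum mulr_sumr.
under eq_bigr do rewrite big_mkcond /=.
rewrite exchange_big /= [RHS]big_mkcond /=; apply: eq_bigr => T _.
case: ifP => [/andP[ST /eqP Tk]|STk]; last first.
  rewrite big1 // => l _; case: ifP => // /andP[/(subset_trans (subsetUr _ _)) ST Tk].
  by rewrite ST Tk in STk.
under eq_bigr do rewrite subUset sub1set ST Tk eqxx !andbT.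
rewrite -big_mkcondr /= sumr_const mulr_natl; congr (_ *+ _).
by rewrite -Tk -(cardsDS ST); apply: eq_card => l; rewrite [in LHS]unfold_in !inE.
Qed.

Lemma notin_setU2 (i j l : 'I_n) S :
  (l \in ~: (i |: (j |: S))) = [&& l != i, l != j & l \notin S].
Proof. by rewrite !inE !negb_or. Qed.

Lemma cardsU2 (i j : 'I_n) S : i != j -> i \notin S -> j \notin S ->
  #|i |: (j |: S)| = (#|S|.+2)%N.
Proof. by move=> ij iS jS; rewrite !cardsU1 !inE negb_or ij iS jS. Qed.

(** An open form of the Lorentzian condition. Only quadratic derivatives are tested, since these are
    what an edge operator is checked on; sets suffice as directions because a repeated derivative
    kills a multiaffine polynomial. *)
Definition good F : Prop :=
  (forall T, #|T| = k -> 0 < F T) /\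
  (forall S, (#|S| + 2)%N = k -> hyperbolic (hess F S)).

Lemma psum_ge0 F S : (forall T, #|T| = k -> 0 <= F T) -> 0 <= psum F S.
Proof. by move=> F0; apply: sumr_ge0 => T /andP[_ /eqP]; apply: F0. Qed.

Hypothesis k_le_n : (k <= n)%N.

Lemma psum_gt0 F S : (forall T, #|T| = k -> 0 < F T) -> (#|S| <= k)%N -> 0 < psum F S.
Proof.
move=> F0; move E : (k - #|S|)%N => m; elim: m S E => [|m IH] S E Sk.
  have {}Sk : #|S| = k by apply/eqP; rewrite eqn_leq Sk -subn_eq0 E.
  by rewrite psum_card // F0.
have lt_Sk : (#|S| < k)%N by rewrite -subn_gt0 E.
have k0 : 0 < (k - #|S|)%:R :> R by rewrite ltr0n E.
rewrite -(pmulr_rgt0 _ k0) -psum_euler.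
have [l lS] : exists l, l \in ~: S.
  apply/card_gt0P; rewrite cardsCs setCK card_ord subn_gt0.
  exact: leq_trans lt_Sk k_le_n.
rewrite (bigD1 l) //=; apply: ltr_pwDl; last first.
  by apply: sumr_ge0 => j _; apply: psum_ge0 => T /F0/ltW.
have cS : #|l |: S| = #|S|.+1 by rewrite cardsU1 -in_setC lS.
by apply: IH; rewrite cS // subnS E.
Qed.

Lemma hess_ge0 F S i j : (forall T, #|T| = k -> 0 <= F T) -> 0 <= hess F S i j.
Proof. by move=> F0; rewrite mxE; case: ifP => // _; apply: psum_ge0. Qed.

Lemma hess_row F S i : i \notin S ->
  \sum_j hess F S i j = (k - #|S|).-1%:R * psum F (i |: S).
Proof.
move=> iS; have -> : (k - #|S|).-1 = (k - #|i |: S|)%N by rewrite cardsU1 iS subnS.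
rewrite -psum_euler.
rewrite [RHS]big_mkcond; apply: eq_bigr => j _; rewrite mxE iS !inE negb_or eq_sym /=.
by case: ifP => // _; rewrite setUCA.
Qed.

(** Induction on the degree of the derivative along [S], starting from quadratics. The step is
    [local_to_global], with the Hessians of one further derivative as the [Q l]. *)
Lemma good_hess F S : good F -> (#|S| + 2 <= k)%N -> hyperbolic (hess F S).
Proof.
case=> F0 Fh; move E : (k - (#|S| + 2))%N => m; elim: m S E => [|m IH] S E Sk.
  by apply: Fh; apply/eqP; rewrite eqn_leq Sk -subn_eq0 E.
have F0' T : #|T| = k -> 0 <= F T by move/F0/ltW.
have ltSk : (#|S| + 2 < k)%N by rewrite -subn_gt0 E.
have kS : (k - #|S|)%N = m.+3 by rewrite -(subnK Sk) E addnCA addKn addn2.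
apply: (@local_to_global _ _ _ (~: S) (fun l => hess F (l |: S)) (m.+1)%:R).
- by rewrite ltr0n.
- exact: hess_sym.
- by move=> l; exact: hess_sym.
- by move=> i j; rewrite inE negbK => iS; rewrite mxE iS andbF.
- by move=> i j; apply: hess_ge0.
- move=> i j; rewrite !inE => iS jS ij; rewrite mxE ij iS jS; apply: psum_gt0 => //.
  by rewrite cardsU2 // -addn2.
- move=> i; rewrite inE => iS; rewrite hess_row // kS mulr_gt0 ?ltr0n //.
  by apply: psum_gt0 => //; rewrite cardsU1 iS (leq_trans _ Sk) // addn2 add1n.
- move=> l; rewrite inE => lS; have cS : #|l |: S| = #|S|.+1 by rewrite cardsU1 lS.
  by apply: IH; rewrite cS ?addSn // subnS E.
- move=> i j; rewrite [in RHS]mxE; under eq_bigr do rewrite mxE.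
  case: ifP => [/and3P[ij iS jS]|ij]; last first.
    rewrite mulr0 big1 // => l lS; case: ifP => // /and3P[ij'].
    rewrite !inE !negb_or => /andP[_ iS] /andP[_ jS].
    by rewrite ij' iS jS in ij.
  have -> : m.+1 = (k - #|i |: (j |: S)|)%N by rewrite cardsU2 // -addn2 subnDA kS subn2.
  rewrite -psum_euler [LHS]big_mkcond [RHS]big_mkcond; apply: eq_bigr => l _.
  rewrite notin_setU2 !inE !negb_or ij iS jS !andbT (eq_sym i) (eq_sym j).
  case: (l != i); case: (l != j); case: (l \in S) => //=.
  by congr psum; rewrite (setUCA [set j]) (setUCA [set i]).
- move=> l i; rewrite inE => lS.
  have [iS|iS] := boolP (i \in l |: S).
    rewrite big1 => [|j _]; last by rewrite mxE iS andbF.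
    rewrite mxE; case: ifP => [/and3P[li _ iS']|]; rewrite ?mulr0 //.
    by move: iS; rewrite !inE eq_sym (negPf li) (negPf iS').
  rewrite hess_row // cardsU1 lS add1n subnS kS /=.
  move: iS; rewrite !inE negb_or => /andP[il iS].
  by rewrite mxE lS iS eq_sym il setUCA.
Qed.

(** Reversed Cauchy-Schwarz between the all-ones vector and a vector in the coordinates [i] and [j].
    In degree [d] it yields the constant [2 (1 - 1/d)], replaced by 2 to be uniform. Below degree
    two the left side is zero. *)
Lemma rayleigh F S i j : good F -> i != j -> i \notin S -> j \notin S ->
  psum F S * psum F (i |: (j |: S)) <= 2 * psum F (i |: S) * psum F (j |: S).
Proof.
move=> gF ij iS jS; have F0 := proj1 gF.
have F0' T : #|T| = k -> 0 <= F T by move/F0/ltW.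
have [Sk|Sk] := leqP (#|S| + 2) k; last first.
  rewrite [X in _ * X]/psum big_pred0 ?mulr0 => [|T].
    by rewrite !mulr_ge0 ?psum_ge0.
  apply/negbTE/negP => /andP[/subset_leq_card]; rewrite cardsU2 // => h /eqP Tk.
  by move: Sk; rewrite addn2 ltnNge -Tk h.
have [m kS] : exists m, (k - #|S|)%N = m.+2.
  by exists (k - #|S| - 2)%N; rewrite -addn2 subnK // leq_subRL ?(leq_trans _ Sk) ?leq_addr.
have h1 x : bform (hess F S) (const_mx 1) x =
    \sum_l x 0 l * (if l \notin S then (m.+1)%:R * psum F (l |: S) else 0).
  rewrite bformE exchange_big /=; apply: eq_bigr => l _.
  under eq_bigr do rewrite [const_mx _ _ _]mxE mulr1.
  rewrite -mulr_suml mulrC; congr (_ * _).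
  case: ifP => lS.
    have -> : m.+1 = (k - #|S|).-1 by rewrite kS.
    by rewrite -hess_row //; apply: eq_bigr => l' _; rewrite -[in LHS]hess_sym mxE.
  by apply: big1 => l' _; rewrite mxE lS !andbF.
have h11 : bform (hess F S) (const_mx 1) (const_mx 1) = (m.+1)%:R * (m.+2)%:R * psum F S.
  rewrite h1 -mulrA -{1}kS -psum_euler mulr_sumr [RHS]big_mkcond /=; apply: eq_bigr => l _.
  by rewrite mxE mul1r inE.
pose a := psum F (i |: S); pose b := psum F (j |: S); pose c := psum F (i |: (j |: S)).
have a0 : 0 < a by apply: psum_gt0 => //; rewrite cardsU1 iS (leq_trans _ Sk) // addn2 add1n.
have b0 : 0 < b by apply: psum_gt0 => //; rewrite cardsU1 jS (leq_trans _ Sk) // addn2 add1n.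
(* The crossed coefficients make both terms of the pairing with the all-ones vector equal, so that
   [a b] cancels in the end. *)
pose y : 'rV[R]_n := b *: delta_mx 0 i + a *: delta_mx 0 j.
have d0 (l : 'I_n) (f : 'I_n -> R) : \sum_p (delta_mx 0 l : 'rV[R]_n) 0 p * f p = f l.
  rewrite (bigD1 l) //= big1 => [|p pl]; rewrite !mxE !eqxx ?(negPf pl) ?mul0r //.
  by rewrite mul1r addr0.
have h1y : bform (hess F S) (const_mx 1) y = 2 * (m.+1)%:R * a * b.
  by rewrite /y bformDr !bformZr !h1 !d0 iS jS -/a -/b; ring.
have hd l l' : bform (hess F S) (delta_mx 0 l) (delta_mx 0 l') = hess F S l l'.
  by rewrite /bform dotvC /dotv d0 -rowE mxE.
have hyy : bform (hess F S) y y = 2 * a * b * c.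
  rewrite /y !(bformDl, bformDr, bformZl, bformZr) !hd !mxE !eqxx (eq_sym j) ij iS jS /=.
  by rewrite [j |: (i |: S)]setUCA -/c; ring.
have := @hyperbolic_CS _ _ _ (const_mx 1) y (hess_sym F S) (good_hess gF Sk).
rewrite h11 h1y hyy -/a -/b -/c; have P0 : 0 <= psum F S by apply: psum_ge0.
have m1 : 0 < (m.+1)%:R :> R by rewrite ltr0n.
have m2 : (m.+2)%:R = (m.+1)%:R + 1 :> R by rewrite -natr1.
move: m1 m2; set u := (m.+1)%:R => m1 -> H.
have {}H := H (mulr_ge0 (mulr_ge0 (ltW m1) (addr_ge0 (ltW m1) ler01)) P0).
have {}H : (2 * u * (a * b)) * ((u + 1) * (psum F S * c)) <= (2 * u * (a * b)) * (2 * u * (a * b)).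
  by apply: le_trans (le_trans H _); rewrite le_eqVlt; apply/orP; left; apply/eqP; ring.
move: H; rewrite ler_pM2l ?mulr_gt0 // => H.
rewrite -(@ler_pM2l _ (u + 1)) ?addr_gt0 //; apply: le_trans H _.
have : 0 <= a * b by rewrite mulr_ge0 // ltW.
nra.
Qed.

(** Rescaling the variables changes each quadratic derivative by a positive factor and a diagonal
    congruence. It transports statements at the all-ones point to any positive point. *)
Lemma good_scale F (w : 'I_n -> R) : (forall i, 0 < w i) -> good F ->
  good (fun T => F T * \prod_(i in T) w i).
Proof.
move=> w0 [F0 Fh]; split => [T Tk|S Sk].
  by rewrite mulr_gt0 ?F0 // prodr_gt0.
pose a := \prod_(i in S) w i; have a0 : 0 < a by rewrite prodr_gt0.
apply: (hyperbolic_diag_congr (w := w) (hyperbolic_scale a0 (Fh S Sk))) => i j.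
rewrite !mxE; case: ifP => [/and3P[ij iS jS]|_]; last by rewrite mulr0 !mul0r.
have c2 : #|i |: (j |: S)| = k by rewrite cardsU2 // -Sk addn2.
by rewrite !psum_card // !big_setU1 ?inE ?negb_or ?ij ?iS //= -/a; ring.
Qed.

Lemma good_pos_scale F c : 0 < c -> good F -> good (fun T => c * F T).
Proof.
move=> c0 [F0 Fh]; split => [T Tk|S Sk]; first by rewrite mulr_gt0 ?F0.
rewrite (_ : hess _ _ = c *: hess F S); first exact: hyperbolic_scale (Fh S Sk).
apply/matrixP => i j; rewrite !mxE; case: ifP => _; rewrite ?mulr0 //.
by rewrite /psum mulr_sumr.
Qed.

End SetFunctions.

(** * Edge operators *)

Section EdgeOperator.
Variables (R : rcfType) (n : nat).
Implicit Types (F : {set 'I_n} -> R) (S T : {set 'I_n}).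

Lemma bform_split2 (M : 'M[R]_n) (a b : 'I_n) y : M^T = M -> a != b ->
  M a a = 0 -> M b b = 0 ->
  bform M y y = 2 * M a b * y 0 a * y 0 b
    + 2 * (y 0 a * (\sum_(l | (l != a) && (l != b)) M a l * y 0 l)
         + y 0 b * (\sum_(l | (l != a) && (l != b)) M b l * y 0 l))
    + \sum_(l | (l != a) && (l != b)) \sum_(m | (m != a) && (m != b))
        M l m * y 0 l * y 0 m.
Proof.
move=> Ms ab Ma Mb; have Mji i j : M j i = M i j by rewrite -{1}Ms mxE.
have sp (f : 'I_n -> R) :
    \sum_i f i = f a + f b + \sum_(l | (l != a) && (l != b)) f l.
  by rewrite (bigD1 a) //= (bigD1 b) 1?eq_sym //= addrA.
rewrite bformE; under eq_bigr do rewrite sp.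
rewrite sp !big_split /= Ma Mb (Mji a b).
rewrite !mulr_sumr.
have e c : \sum_(l | (l != a) && (l != b)) M l c * y 0 l * y 0 c
         = y 0 c * \sum_(l | (l != a) && (l != b)) M c l * y 0 l.
  by rewrite mulr_sumr; apply: eq_bigr => l _; rewrite (Mji c l); ring.
have e' c : \sum_(l | (l != a) && (l != b)) M c l * y 0 c * y 0 l
         = y 0 c * \sum_(l | (l != a) && (l != b)) M c l * y 0 l.
  by rewrite mulr_sumr; apply: eq_bigr => l _; ring.
by rewrite !e !e' -!mulr_sumr; ring.
Qed.

(* With [z] the image of [y] under the mixing of the coordinates [a] and [b],
   [bform M' y y - bform M z z] is [- M a b / 2] times
   [(y_a + y_b)^2 ((al + be)^2 - 1) + (y_a - y_b)^2 (1 - (al - be)^2)]. *)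
Lemma hyperbolic_mix (M M' : 'M[R]_n) (a b : 'I_n) (al be : R) :
  M^T = M -> M'^T = M' -> a != b ->
  M a a = 0 -> M b b = 0 -> M' a a = 0 -> M' b b = 0 -> 0 <= M a b ->
  M' a b = M a b ->
  (forall l, l != a -> l != b -> M' a l = al * M a l + be * M b l) ->
  (forall l, l != a -> l != b -> M' b l = al * M b l + be * M a l) ->
  (forall l m, l != a -> l != b -> m != a -> m != b -> M' l m = M l m) ->
  1 <= (al + be) ^+ 2 -> (al - be) ^+ 2 <= 1 ->
  hyperbolic M -> hyperbolic M'.
Proof.
move=> Ms Ms' ab Ma Mb Ma' Mb' Mab Mab' M'a M'b M'l h1 h2 hM.
pose L : 'M[R]_n := \matrix_(i, j)
  if j == a then al * (i == a)%:R + be * (i == b)%:R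
  else if j == b then be * (i == a)%:R + al * (i == b)%:R else (i == j)%:R.
have dl (y : 'rV[R]_n) c : \sum_i y 0 i * (i == c)%:R = y 0 c.
  rewrite (bigD1 c) //= eqxx mulr1 big1 ?addr0 // => i /negPf ->; exact: mulr0.
apply: (hyperbolic_sub (L := L) hM) => y.
have ba : (b == a) = false by rewrite eq_sym (negPf ab).
have za : (y *m L) 0 a = al * y 0 a + be * y 0 b.
  rewrite mxE -!(dl y) !mulr_sumr -big_split; apply: eq_bigr => i _ /=.
  by rewrite mxE eqxx; ring.
have zb : (y *m L) 0 b = be * y 0 a + al * y 0 b.
  rewrite mxE -!(dl y) !mulr_sumr -big_split; apply: eq_bigr => i _ /=.
  by rewrite mxE eqxx ba; ring.
have zl l : l != a -> l != b -> (y *m L) 0 l = y 0 l.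
  move=> la lb; rewrite mxE -[RHS](dl y); apply: eq_bigr => i _ /=.
  by rewrite mxE (negPf la) (negPf lb).
rewrite (bform_split2 _ Ms' ab Ma' Mb') (bform_split2 _ Ms ab Ma Mb) za zb Mab'.
have eA c : \sum_(l | (l != a) && (l != b)) M c l * (y *m L) 0 l =
            \sum_(l | (l != a) && (l != b)) M c l * y 0 l.
  by apply: eq_bigr => l /andP[la lb]; rewrite zl.
rewrite !eA.
have -> : \sum_(l | (l != a) && (l != b)) M' a l * y 0 l =
    al * \sum_(l | (l != a) && (l != b)) M a l * y 0 l +
    be * \sum_(l | (l != a) && (l != b)) M b l * y 0 l.
  rewrite !mulr_sumr -big_split; apply: eq_bigr => l /andP[la lb] /=.
  by rewrite M'a //; ring.
have -> : \sum_(l | (l != a) && (l != b)) M' b l * y 0 l =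
    al * \sum_(l | (l != a) && (l != b)) M b l * y 0 l +
    be * \sum_(l | (l != a) && (l != b)) M a l * y 0 l.
  rewrite !mulr_sumr -big_split; apply: eq_bigr => l /andP[la lb] /=.
  by rewrite M'b //; ring.
have -> : \sum_(l | (l != a) && (l != b)) \sum_(m | (m != a) && (m != b))
        M' l m * y 0 l * y 0 m =
    \sum_(l | (l != a) && (l != b)) \sum_(m | (m != a) && (m != b))
        M l m * (y *m L) 0 l * (y *m L) 0 m.
  apply: eq_bigr => l /andP[la lb]; apply: eq_bigr => m /andP[ma mb].
  by rewrite M'l // !zl.
rewrite lerD2r; set A := \sum_(_ | _) _; set B := \sum_(_ | _) _.
move: (y 0 a) (y 0 b) => u v.
have key : 0 <= (u + v) ^+ 2 * ((al + be) ^+ 2 - 1) + (u - v) ^+ 2 * (1 - (al - be) ^+ 2).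
  by rewrite addr_ge0 // mulr_ge0 ?sqr_ge0 // subr_ge0.
have : 0 <= M a b * ((u + v) ^+ 2 * ((al + be) ^+ 2 - 1) + (u - v) ^+ 2 * (1 - (al - be) ^+ 2)).
  exact: mulr_ge0.
rewrite -subr_ge0 => key2; rewrite -subr_ge0.
rewrite -(@pmulr_rge0 _ 2) ?ltr0n //; apply: le_trans key2 _.
by rewrite le_eqVlt; apply/orP; left; apply/eqP; ring.
Qed.

Definition edge_op (e : {set 'I_n}) (al be : R) (F : {set 'I_n} -> R) T : R :=
  if #|T :&: e| == 1%N then al * F T + be * F (symdiff T e) else F T.

Lemma card_pair_inter (a b : 'I_n) (T : {set 'I_n}) : a != b ->
  #|T :&: [set a; b]| = ((a \in T) + (b \in T))%N.
Proof.
move=> ab; rewrite -sum1_card setIC.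
under eq_bigl do rewrite inE.
by rewrite big_mkcondr /= big_setU1 ?inE //= big_set1; case: (a \in T); case: (b \in T).
Qed.

Lemma card_symdiff (e T : {set 'I_n}) : #|e| = 2%N -> #|T :&: e| = 1%N ->
  #|symdiff T e| = #|T|.
Proof.
move=> e2 Te; rewrite /symdiff cardsU.
have -> : (T :\: e) :&: (e :\: T) = set0.
  by apply/setP => i; rewrite !inE; case: (i \in e); case: (i \in T).
rewrite cards0 subn0 !cardsD (setIC e) Te e2 subn1 addn1 prednK // -Te.
exact: subset_leq_card (subsetIl _ _).
Qed.

Variables (k : nat).
Hypothesis k_le_n : (k <= n)%N.
Variables (a b : 'I_n) (al be : R).
Hypotheses (ab : a != b) (al_gt0 : 0 < al) (be_ge0 : 0 <= be).
Hypotheses (h1 : 1 <= (al + be) ^+ 2) (h2 : (al - be) ^+ 2 <= 1).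

Let e := [set a; b].

Let hess_kE F S i j : (#|S| + 2)%N = k -> hess k F S i j =
  if [&& i != j, i \notin S & j \notin S] then F (i |: (j |: S)) else 0.
Proof.
move=> Sk; rewrite mxE; case: ifP => // /and3P[ij iS jS].
by rewrite psum_card // cardsU2 // -Sk addn2.
Qed.

Let edgeE F T : edge_op e al be F T =
  if (a \in T) (+) (b \in T) then al * F T + be * F (symdiff T e) else F T.
Proof.
by rewrite /edge_op card_pair_inter //; case: (a \in T); case: (b \in T).
Qed.

(** Both variables survive in the Hessian: rows [a] and [b] are mixed, and the entry at [(a, b)]
    stays because its set contains the whole edge. This is the situation of [hyperbolic_mix]. *)
Let case_disjoint F S : good k F -> (#|S| + 2)%N = k -> a \notin S -> b \notin S ->
  hyperbolic (hess k (edge_op e al be F) S).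
Proof.
move=> gF Sk aS bS; have Fh := proj2 gF S Sk.
have ba : b != a by rewrite eq_sym.
have sa l : l != a -> l != b -> symdiff (a |: (l |: S)) e = b |: (l |: S).
  move=> la lb; apply/setP => i; rewrite !inE.
  have [->|ia] := eqVneq i a; first by rewrite ?eqxx ?(negPf ab) /= ?(eq_sym a) ?(negPf la) (negPf aS).
  by have [->|ib] := eqVneq i b; rewrite ?(eq_sym b l) ?(negPf lb) ?(negPf bS) /= ?andbF ?orbF.
have sb l : l != a -> l != b -> symdiff (b |: (l |: S)) e = a |: (l |: S).
  move=> la lb; apply/setP => i; rewrite !inE.
  have [->|ia] := eqVneq i a; first by rewrite ?eqxx ?(negPf ab) /= ?(eq_sym a) ?(negPf la) (negPf aS).
  by have [->|ib] := eqVneq i b; rewrite ?(eq_sym b l) ?(negPf lb) ?(negPf bS) /= ?andbF ?orbF.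
apply: (hyperbolic_mix (M := hess k F S) (a := a) (b := b) (al := al) (be := be)) => //;
  try exact: hess_sym; rewrite ?hess_kE ?eqxx //.
- by case: ifP => // /and3P[*]; apply/ltW/(proj1 gF); rewrite cardsU2 // -Sk addn2.
- by rewrite edgeE !inE !eqxx orbT.
- move=> l la lb; rewrite !hess_kE // aS bS !(eq_sym _ l) la lb /=.
  case: ifP => _; last by rewrite !mulr0 addr0.
  by rewrite edgeE !inE eqxx (negPf ba) !(eq_sym _ l) (negPf lb) (negPf bS) /= sa.
- move=> l la lb; rewrite !hess_kE // aS bS !(eq_sym _ l) la lb /=.
  case: ifP => _; last by rewrite !mulr0 addr0.
  by rewrite edgeE !inE eqxx (negPf ab) !(eq_sym _ l) (negPf la) (negPf aS) /= sb.
- move=> l m la lb ma mb; rewrite !hess_kE //; case: ifP => // _.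
  by rewrite edgeE !inE !(eq_sym a) !(eq_sym b) (negPf la) (negPf lb) (negPf ma)
    (negPf mb) (negPf aS) (negPf bS).
Qed.

Let case_both F S : good k F -> (#|S| + 2)%N = k -> a \in S -> b \in S ->
  hyperbolic (hess k (edge_op e al be F) S).
Proof.
move=> gF Sk aS bS; have Fh := proj2 gF S Sk.
rewrite (_ : hess _ _ _ = hess k F S) //; apply/matrixP => i j.
by rewrite !hess_kE //; case: ifP => // _; rewrite edgeE !inE aS bS !orbT.
Qed.

(* The weights [al] at [a], [be] at [b] and [0] elsewhere turn the directional
   derivative into the contraction of the edge operator; they are approached
   by positive weights. *)
Let case_one F S : good k F -> (#|S| + 2)%N = k -> a \in S -> b \notin S ->
  hyperbolic (hess k (edge_op e al be F) S).
Proof.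
move=> gF Sk aS bS; have [S0 S0E] : exists S0, S0 = S :\ a by exists (S :\ a).
have F0 := proj1 gF.
have SE : S = a |: S0 by rewrite S0E setD1K.
have aS0 : a \notin S0 by rewrite S0E !inE eqxx.
have bS0 : b \notin S0 by rewrite S0E !inE (negPf bS) andbF.
have S0k : (#|S0| + 3)%N = k by rewrite -Sk SE cardsU1 aS0 add1n addn3 addn2.
(* [N v] is the Hessian of the derivative in direction [v] of the cubic obtained by differentiating
   along [S0]; it is linear in [v]. *)
pose N (v : 'I_n -> R) : 'M[R]_n := \matrix_(i, j)
  if [&& i != j, i \notin S0 & j \notin S0]
  then \sum_(l in ~: (i |: (j |: S0))) v l * F (l |: (i |: (j |: S0))) else 0.
have c3 i j l : i != j -> i \notin S0 -> j \notin S0 -> l \in ~: (i |: (j |: S0)) ->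
    #|l |: (i |: (j |: S0))| = k.
  by rewrite in_setC => ij iS jS lS; rewrite cardsU1 lS cardsU2 // -S0k addn3.
have Nsym v : (N v)^T = N v.
  by apply/matrixP => i j; rewrite !mxE eq_sym setUCA andbA andbAC -andbA.
have N0 v : (forall i, 0 <= v i) -> forall i j, 0 <= N v i j.
  move=> v0 i j; rewrite mxE; case: ifP => // /and3P[ij iS jS].
  by apply: sumr_ge0 => l lS; rewrite mulr_ge0 // ltW // F0 // c3.
(* Rescaling the variables by [v] turns direction [v] into the all-ones direction, where Euler's
   identity identifies [N v] with the Hessian of the rescaled cubic up to a diagonal congruence. *)
have Nh v : (forall i, 0 < v i) -> hyperbolic (N v).
  move=> v0; pose Fv T := F T * \prod_(i in T) v i.
  have gFv : good k Fv by apply: good_scale.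
  have hFv : hyperbolic (hess k Fv S0).
    by apply: good_hess => //; rewrite -S0k leq_add2l.
  pose c := \prod_(i in S0) v i; have c0 : 0 < c by rewrite prodr_gt0.
  have ci : 0 < c^-1 by rewrite invr_gt0.
  apply: (hyperbolic_diag_congr (w := fun i => (v i)^-1) (hyperbolic_scale ci hFv)) => i j.
  rewrite !mxE; case: ifP => [/and3P[ij iS jS]|_]; last by rewrite mulr0 !mul0r.
  have c2 : (k - #|i |: (j |: S0)|)%N = 1%N by rewrite cardsU2 // -S0k addn3 subSnn.
  have := psum_euler k Fv (i |: (j |: S0)); rewrite c2 mul1r => <-.
  rewrite mulr_sumr !mulr_suml; apply: eq_bigr => l lS.
  have lS' : l \notin i |: (j |: S0) by rewrite -in_setC.
  rewrite psum_card ?c3 // /Fv big_setU1 //= !big_setU1 ?inE ?negb_or ?ij ?iS //= -/c.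
  by field; rewrite !gt_eqF.
pose wa i : R := if i == a then al else if i == b then be else 0.
pose wb i : R := if i == a then 0 else 1.
have v0_ge0 i : 0 <= wa i by rewrite /wa; case: ifP => _; [exact: ltW|case: ifP].
have v1_ge0 i : 0 <= wb i by rewrite /wb; case: ifP.
have hN : hyperbolic (N wa).
  apply: (hyperbolic_lim (M' := N wb)) => //; try exact: N0.
  move=> t t0; rewrite (_ : _ + _ = N (fun i => wa i + t * wb i)).
    apply: Nh => i; rewrite /wa /wb; case: ifP => _; first by rewrite mulr0 addr0.
    by rewrite mulr1; case: ifP => _; rewrite ?add0r // ltr_wpDl.
  apply/matrixP => i j; rewrite !mxE; case: ifP => _; last by rewrite mulr0 addr0.
  by rewrite mulr_sumr -big_split; apply: eq_bigr => l _ /=; ring.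
(* The weight 0 erases [a], which lies in [S]. In row [b] the sets contain both endpoints, so the
   edge operator leaves the coefficient alone while [N wa] multiplies it by [al]; hence [al^-1]. *)
pose w i : R := if i == a then 0 else if i == b then al^-1 else 1.
have v0sum i j : i != j -> i \notin S0 -> j \notin S0 -> i != a -> j != a ->
  \sum_(l in ~: (i |: (j |: S0))) wa l * F (l |: (i |: (j |: S0))) =
  al * F (i |: (j |: S)) + (if (b != i) && (b != j) then be * F (b |: (i |: (j |: S0))) else 0).
  move=> ij iS jS ia ja.
  rewrite (bigD1 a) /=; last by rewrite notin_setU2 !(eq_sym a) ia ja aS0.
  have -> : a |: (i |: (j |: S0)) = i |: (j |: S) by rewrite (setUCA [set a]) (setUCA [set a]) -SE.
  rewrite /wa eqxx; congr (_ + _).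
  rewrite big_mkcond (bigD1 b) //= big1 ?addr0.
    by rewrite notin_setU2 bS0 andbT (eq_sym b a) (negPf ab) andbT eqxx.
  by move=> l lb; case: ifP => // /andP[_ /negPf ->]; rewrite (negPf lb) mul0r.
have wa0 : w a = 0 by rewrite /w eqxx.
apply: (hyperbolic_diag_congr (w := w) hN) => i j.
rewrite hess_kE // [N wa i j]mxE {1 2}SE !inE !negb_or.
have [->|ia] := eqVneq i a; first by rewrite wa0 /= !(mulr0, mul0r) andbF.
have [->|ja] := eqVneq j a; first by rewrite wa0 /= !mulr0 !andbF.
case: ifP => [/and3P[ij iS jS]|_] /=; last by rewrite !mul0r.
rewrite v0sum ?iS ?jS // edgeE !inE aS !orbT /= (negPf bS) orbF.
have [bi|bi] /= := eqVneq b i.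
  rewrite addr0 /w (negPf ia) (negPf ja) -bi eqxx.
  by rewrite (negPf (_ : j != b)) ?mulr1; [field; rewrite gt_eqF|rewrite bi eq_sym].
have [bj|bj] /= := eqVneq b j.
  rewrite addr0 /w (negPf ia) (negPf ja) -bj eqxx.
  by rewrite (negPf (_ : i != b)) ?mulr1; [field; rewrite gt_eqF|rewrite bj].
rewrite /w (negPf ia) (negPf ja) !(eq_sym _ b) (negPf bi) (negPf bj) !mulr1.
congr (_ + _ * F _); apply/setP => l; rewrite !inE.
have [->|la] := eqVneq l a; first by
  rewrite aS !orbT /= ?(negPf ab) ?(eq_sym a) ?(eq_sym b a) ?(negPf ab)
    ?(negPf ia) ?(negPf ja) (negPf aS0).
have -> : (l \in S) = (l \in S0) by rewrite SE !inE (negPf la).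
by have [->|lb] := eqVneq l b; rewrite ?(negPf bS0) ?(negPf bi) ?(negPf bj) ?(negPf bS) ?andbF ?orbF.
Qed.

Lemma edge_op_pos F : good k F ->
  forall T, #|T| = k -> 0 < edge_op e al be F T.
Proof.
move=> gF T Tk; rewrite /edge_op; case: eqP => [Te|_]; last exact: (proj1 gF).
rewrite ltr_pwDl ?mulr_gt0 ?(proj1 gF) // mulr_ge0 // ltW // (proj1 gF) //.
by rewrite card_symdiff // cards2 ab.
Qed.

Lemma edge_op_hyperbolic F S : good k F -> (#|S| + 2)%N = k -> a \in S ->
  hyperbolic (hess k (edge_op e al be F) S).
Proof.
move=> gF Sk aS; have [bS|bS] := boolP (b \in S); first exact: case_both.
exact: case_one.
Qed.

Lemma edge_op_hyperbolic0 F S : good k F -> (#|S| + 2)%N = k ->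
  a \notin S -> b \notin S -> hyperbolic (hess k (edge_op e al be F) S).
Proof. exact: case_disjoint. Qed.

End EdgeOperator.

Lemma edge_op_good (R : rcfType) (n k : nat) (e : {set 'I_n}) (al be : R) F :
  (k <= n)%N -> #|e| = 2%N -> 0 < al -> 0 <= be ->
  1 <= (al + be) ^+ 2 -> (al - be) ^+ 2 <= 1 ->
  good k F -> good k (edge_op e al be F).
Proof.
move=> kn /eqP/cards2P[a [b [ab ->]]] al0 be0 h1 h2 gF; split.
  exact: edge_op_pos.
move=> S Sk; have [aS|aS] := boolP (a \in S); first exact: edge_op_hyperbolic.
have [bS|bS] := boolP (b \in S); last exact: edge_op_hyperbolic0.
by rewrite setUC; apply: edge_op_hyperbolic; rewrite // eq_sym.
Qed.

(** * Exchange property and limits *)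

Section Exchange.
Variables (R : rcfType) (n k : nat).
Implicit Types (X : {set 'I_n} -> R) (S T : {set 'I_n}).

(** The [psum] of this along [S] is the derivative along [S] at the point [w], times the monomial of
    [S]; these monomials balance in the Rayleigh inequality. *)
Definition weighted (w : 'I_n -> R) X T : R := X T * \prod_(i in T) w i.

Lemma prod_le_small (w : 'I_n -> R) (t : R) T l :
  (forall i, 0 <= w i <= 1) -> l \in T -> w l = t -> \prod_(i in T) w i <= t.
Proof.
move=> w01 lT wl; have [w0 _] := andP (w01 l).
by rewrite (bigD1 l) //= wl ler_piMr -?wl // prodr_ile1.
Qed.

Lemma psum_le_scale X (w : 'I_n -> R) (t : R) S :
  (forall T, #|T| = k -> 0 <= X T) -> 0 <= t ->
  (forall T, S \subset T -> #|T| = k -> 0 < X T -> \prod_(i in T) w i <= t) ->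
  psum k (weighted w X) S <= t * psum k X finset.set0.
Proof.
move=> X0 t0 h; rewrite /psum mulr_sumr.
rewrite big_mkcond [leRHS]big_mkcond /=; apply: ler_sum => T _; rewrite sub0set /=.
have [Tk|_] := eqVneq #|T| k; last by rewrite andbF.
rewrite andbT; case: ifP => [ST|_]; last by rewrite mulr_ge0 ?X0.
rewrite /weighted mulrC; have := X0 T Tk; rewrite le_eqVlt => /orP[/eqP<-|XT].
  by rewrite !mulr0.
by rewrite ler_wpM2r ?X0 // h.
Qed.

Lemma psum_ge_term X S T : (forall T, #|T| = k -> 0 <= X T) ->
  S \subset T -> #|T| = k -> X T <= psum k X S.
Proof.
move=> X0 ST Tk; rewrite /psum (bigD1 T) /= ?ST ?Tk ?eqxx // lerDl.
by apply: sumr_ge0 => T' /andP[/andP[_ /eqP]] /X0.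
Qed.

(* For [B] with [B :\: A] minimal, [ray] is applied at [S = A :&: B], to [i] and
   a second element [a] of [A :\: B], with weight [t] at [i] and outside
   [A :|: B] and weight 1 elsewhere: the left side is at least [t X A X B], while
   a term of order [t^0] in the derivative along [a] would contradict
   minimality, so the right side is of order [t^2]. *)
Lemma support_exchange X :
  (forall T, #|T| = k -> 0 <= X T) ->
  (forall (w : 'I_n -> R) S i j, (forall l, 0 < w l) ->
     i != j -> i \notin S -> j \notin S ->
     psum k (weighted w X) S * psum k (weighted w X) (i |: (j |: S))
     <= 2 * psum k (weighted w X) (i |: S) * psum k (weighted w X) (j |: S)) ->
  forall (A B : {set 'I_n}) i, #|A| = k -> #|B| = k -> 0 < X A -> 0 < X B ->
  i \in A -> i \notin B ->
  exists2 j, j \in B :\: A & 0 < X (j |: (A :\ i)).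
Proof.
move=> X0 ray A B i Ak Bk XA XB iA iB.
have [m] := ubnP #|B :\: A|; elim: m B Bk XB iB => // m IH B Bk XB iB.
rewrite ltnS => Bm.
have cardAB : #|A :\: B| = #|B :\: A| by rewrite !cardsD Ak Bk finset.setIC.
have iAB : i \in A :\: B by rewrite inE iB iA.
have [/existsP[a /andP[aAB ai]]|none] := boolP [exists a, (a \in A :\: B) && (a != i)]; last first.
  have ABi : A :\: B = [set i]%SET.
    apply/setP => a; rewrite in_set1; apply/idP/eqP => [aAB|->//].
    by apply/eqP; apply: contraNT none => ai; apply/existsP; exists a; rewrite aAB ai.
  have /eqP/cards1P[j BAj] : #|B :\: A| = 1%N by rewrite -cardAB ABi cards1.
  exists j; first by rewrite BAj in_set1.
  suff -> : j |: (A :\ i) = B by [].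
  apply/setP => l; have /setP/(_ l) := BAj; have /setP/(_ l) := ABi.
  rewrite !inE; case: (l \in A); case: (l \in B); case: (l == i); case: (l == j) => //=.
(* A closer [B1] between intersection and union may replace [B], since then [B1 :\: A] lies in
   [B :\: A]. *)
have [/existsP[B1 /and5P[/eqP B1k XB1 iB1 /andP[sub1 sub2] lt1]]|none] :=
  boolP [exists B1 : {set 'I_n}, [&& #|B1| == k, 0 < X B1, i \notin B1,
     (A :&: B \subset B1) && (B1 \subset A :|: B) & (#|B1 :\: A| < #|B :\: A|)%N]].
  have [j jB1 Xj] := IH B1 B1k XB1 iB1 (leq_trans lt1 Bm).
  exists j => //; move: jB1; rewrite !inE => /andP[jA jB1]; rewrite jA.
  by have := fintype.subsetP sub2 _ jB1; rewrite inE (negPf jA).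
exfalso; pose S := A :&: B.
have iS : i \notin S by rewrite inE (negPf iB) andbF.
have [aA aB] : a \in A /\ a \notin B by move: aAB; rewrite inE => /andP[].
have aS : a \notin S by rewrite inE (negPf aB) andbF.
pose C := psum k X finset.set0.
have C0 : 0 <= C by apply: psum_ge0.
have key t : 0 < t -> t <= 1 -> X B * X A <= t * (2 * C ^+ 2).
  move=> t0 t1.
  pose w l : R := if (l \in A :|: B) && (l != i) then 1 else t.
  have w0 l : 0 < w l by rewrite /w; case: ifP.
  have w01 l : 0 <= w l <= 1 by rewrite ltW //= /w; case: ifP.
  have wi : w i = t by rewrite /w eqxx andbF.
  have wX0 T : #|T| = k -> 0 <= weighted w X T.
    by move=> Tk; rewrite mulr_ge0 ?X0 // prodr_ge0 // => l _; rewrite ltW.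
  have w1 l : l \in A :|: B -> l != i -> w l = 1 by rewrite /w => -> ->.
  have ia : i != a by rewrite eq_sym.
  have := ray w S i a w0 ia iS aS.
  have e1 : X B <= psum k (weighted w X) S.
    rewrite (le_trans _ (psum_ge_term wX0 (subsetIr _ _) Bk)) //.
    rewrite /weighted big1 ?mulr1 // => l lB; apply: w1; first by rewrite inE lB orbT.
    by apply: contraNneq iB => <-.
  have e2 : t * X A <= psum k (weighted w X) (i |: (a |: S)).
    have sA : i |: (a |: S) \subset A.
      by rewrite !subUset !sub1set iA aA subsetIl.
    rewrite (le_trans _ (psum_ge_term wX0 sA Ak)) //.
    rewrite /weighted (bigD1 i) //= wi big1 ?mulr1 1?mulrC // => l /andP[lA li].
    by apply: w1; rewrite // inE lA.
  have e3 : psum k (weighted w X) (i |: S) <= t * C.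
    apply: psum_le_scale (ltW t0) _ => // T /fintype.subsetP sT _ _.
    by apply: (prod_le_small (l := i)) => //; apply: sT; rewrite !inE eqxx.
  have e4 : psum k (weighted w X) (a |: S) <= t * C.
    apply: psum_le_scale (ltW t0) _ => // T sT Tk XT.
    have [iT|iT] := boolP (i \in T); first exact: (prod_le_small (l := i)).
    have [TAB|/fintype.subsetPn[l lT lAB]] := boolP (T \subset A :|: B); last first.
      by apply: (prod_le_small (l := l)) => //; rewrite /w (negPf lAB).
    (* Such a [T] meets [A] in [S] and also in [a], so it is strictly closer to [A] than [B] is. *)
    case/negP: none; apply/existsP; exists T; rewrite Tk eqxx XT iT TAB andbT /=.
    have sST : S \subset T by apply: subset_trans sT; apply: subsetUr.
    rewrite sST /= !cardsD Tk Bk.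
    have ltAT : (#|B :&: A| < #|T :&: A|)%N.
      have : (#|a |: S| <= #|T :&: A|)%N.
        apply: subset_leq_card; rewrite subsetI sT subUset sub1set aA; exact: subsetIl.
      by rewrite cardsU1 aS add1n (finset.setIC B).
    have : (#|T :&: A| <= k)%N by rewrite -Tk subset_leq_card // subsetIl.
    by move=> TAk; rewrite ltn_sub2l // (leq_trans ltAT).
  have p0 U : 0 <= psum k (weighted w X) U by apply: psum_ge0.
  move=> H; rewrite -(ler_pM2l t0).
  have H1 : X B * (t * X A) <= psum k (weighted w X) S * psum k (weighted w X) (i |: (a |: S)).
    by apply: ler_pM => //; rewrite ?mulr_ge0 // ltW.
  have H2 : 2 * psum k (weighted w X) (i |: S) * psum k (weighted w X) (a |: S)
     <= 2 * (t * C) * (t * C).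
    by apply: ler_pM => //; rewrite ?mulr_ge0 // ler_pM2l.
  apply: le_trans (_ : X B * (t * X A) <= _); first by rewrite mulrCA.
  apply: le_trans H1 (le_trans H (le_trans H2 _)).
  by rewrite le_eqVlt; apply/orP; left; apply/eqP; ring.
suff : X B * X A <= 0 by rewrite leNgt mulr_gt0.
apply: (@le0_of_small _ _ (- (2 * C ^+ 2)) 0) => e e0.
rewrite mulr0 addr0 mulrN subr_le0.
have [e1|e1] := leP e 1; first exact: key.
apply: le_trans (key 1 ltr01 (lexx _)) _; rewrite ler_wpM2r ?(ltW e1) //.
by rewrite mulr_ge0 // sqr_ge0.
Qed.

End Exchange.

Section Limits.
Local Open Scope classical_set_scope.
Local Open Scope ring_scope.
Variables (R : realType) (n k : nat).
Implicit Types (X : {set 'I_n} -> R) (S T : {set 'I_n}).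

Lemma cvg_sumr (I : finType) (P : pred I) (f : I -> nat -> R) (l : I -> R) :
  (forall i, P i -> f i N @[N --> \oo] --> l i) ->
  \sum_(i | P i) f i N @[N --> \oo] --> \sum_(i | P i) l i.
Proof.
move=> h; rewrite /index_enum; elim: (Finite.enum _ : seq I) => [|i s IH].
  by rewrite big_nil; under eq_fun do rewrite big_nil; exact: cvg_cst.
rewrite big_cons; under eq_fun do rewrite big_cons.
by case: ifP => [Pi|_] //; apply: cvgD => //; exact: h.
Qed.

Definition good_limit X : Prop := exists2 F : nat -> {set 'I_n} -> R,
  (forall N, good k (F N)) &
  (forall T, #|T| = k -> F N T @[N --> \oo] --> X T).

Hypothesis k_le_n : (k <= n)%N.
Variable X : {set 'I_n} -> R.
Hypothesis Xlim : good_limit X.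

Lemma good_limit_ge0 T : #|T| = k -> 0 <= X T.
Proof.
case: Xlim => F gF FX Tk; apply: (cvgr_to_ge (FX T Tk)).
by apply: nearW => N; apply/ltW/(proj1 (gF N)).
Qed.

Let cvg_psum (F : nat -> {set 'I_n} -> R) (Y : {set 'I_n} -> R) S :
  (forall T, #|T| = k -> F N T @[N --> \oo] --> Y T) ->
  psum k (F N) S @[N --> \oo] --> psum k Y S.
Proof. by move=> h; apply: cvg_sumr => T /andP[_ /eqP]; apply: h. Qed.

(** Reversed Cauchy-Schwarz compares convergent sequences, and [hyperbolic_nonneg] recovers
    hyperbolicity from its limit. *)
Lemma good_limit_hyperbolic S : (#|S| + 2)%N = k -> hyperbolic (hess k X S).
Proof.
case: (Xlim) => F gF FX Sk; have X0 := good_limit_ge0.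
apply: hyperbolic_nonneg => [i j|y]; first exact: hess_ge0.
have cvg_hess i j : hess k (F N) S i j @[N --> \oo] --> hess k X S i j.
  rewrite mxE; under eq_fun do rewrite mxE.
  by case: ifP => _; [exact: cvg_psum|exact: cvg_cst].
have cvg_bform x z : bform (hess k (F N) S) x z @[N --> \oo] --> bform (hess k X S) x z.
  rewrite bformE; under eq_fun do rewrite bformE.
  apply: cvg_sumr => i _; apply: cvg_sumr => j _.
  apply: cvgM; last exact: cvg_cst.
  by apply: cvgM; [exact: cvg_hess|exact: cvg_cst].
apply: (ler_cvg_to (cvgM (cvg_bform _ _) (cvg_bform _ _)) (cvgM (cvg_bform _ _) (cvg_bform _ _))).
apply: nearW => N /=; have F0 T : #|T| = k -> 0 <= F N T by move/(proj1 (gF N))/ltW.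
apply: hyperbolic_CS; first exact: hess_sym.
  exact: (proj2 (gF N)).
by rewrite bform1; apply: sumr_ge0 => i _; apply: sumr_ge0 => j _; apply: hess_ge0.
Qed.

Lemma good_limit_rayleigh (w : 'I_n -> R) S i j : (forall l, 0 < w l) ->
  i != j -> i \notin S -> j \notin S ->
  psum k (weighted w X) S * psum k (weighted w X) (i |: (j |: S))
  <= 2 * psum k (weighted w X) (i |: S) * psum k (weighted w X) (j |: S).
Proof.
case: (Xlim) => F gF FX w0 ij iS jS.
have c U : psum k (weighted w (F N)) U @[N --> \oo] --> psum k (weighted w X) U.
  apply: cvg_psum => T Tk; apply: cvgM; [exact: FX|exact: cvg_cst].
apply: (ler_cvg_to (cvgM (c _) (c _)) (cvgM (cvgM (cvg_cst _) (c _)) (c _))).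
apply: nearW => N /=; apply: rayleigh => //; exact: good_scale.
Qed.

Lemma good_limit_exchange (A B : {set 'I_n}) i :
  #|A| = k -> #|B| = k -> 0 < X A -> 0 < X B -> i \in A -> i \notin B ->
  exists2 j, j \in B :\: A & 0 < X (j |: (A :\ i)).
Proof. exact: support_exchange good_limit_ge0 good_limit_rayleigh _ _ _. Qed.

End Limits.

(** * Multiaffine polynomials and the Lorentzian conditions *)

Section SubsetPolynomials.
Variables (R : realType) (n k : nat).
Implicit Types (F : {set 'I_n} -> R) (S T : {set 'I_n}).

Definition kvector F : 'rV[R]_#|ksubsets n k| := \row_a F (ksub a).

Lemma card_ksub (a : 'I_#|ksubsets n k|) : #|ksub a| = k.
Proof. by have := enum_valP a; rewrite inE => /eqP. Qed.

(** The derivative along [S] in squarefree monomials; differentiating again either enlarges [S] or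
    gives zero. *)
Definition deriv_poly F S : mpoly n R :=
  \sum_(T : {set 'I_n} | (S \subset T) && (#|T| == k)) F T *: mpolyX R (mesym1 (T :\: S)).

Lemma ksubset_polyE F : ksubset_poly (kvector F) = deriv_poly F set0.
Proof.
rewrite /ksubset_poly /deriv_poly.
transitivity (\sum_(T in ksubsets n k) F T *: mpolyX R (mesym1 T)).
  rewrite [RHS]big_enum_val; apply: eq_bigr => a _; rewrite mxE; congr (_ *: _).
  rewrite [RHS]mpolyXE_id big_mkcond /=; apply: eq_bigr => i _.
  by rewrite mnmE; case: ifP => _; rewrite ?expr1 ?expr0.
by apply: eq_big => [T|T _]; rewrite ?sub0set ?inE // setD0.
Qed.

Lemma mderiv_deriv_poly F S i :
  mderiv i (deriv_poly F S) = if i \in S then 0 else deriv_poly F (i |: S).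
Proof.
rewrite /deriv_poly linear_sum /=.
under eq_bigr do rewrite linearZ /= mderivX mnmE !inE.
case: ifP => iS; first by rewrite big1 // => T _; rewrite scale0r scaler0.
rewrite big_mkcond [RHS]big_mkcond; apply: eq_bigr => T _.
rewrite subUset sub1set; case: (S \subset T) => //=; last by rewrite andbF.
rewrite andbT; have [iT|iT] /= := boolP (i \in T); last first.
  by case: ifP => // _; rewrite scale0r scaler0.
case: ifP => // _; rewrite scale1r; congr (_ *: mpolyX _ _).
apply/mnmP => j; rewrite mnmBE mnm1E !mnmE !inE.
have [<-|ij] := eqVneq i j; first by rewrite iS iT.
by rewrite subn0.
Qed.

Lemma iter_deriv_poly F (s : seq 'I_n) :
  iter_deriv s (deriv_poly F set0) =
  if uniq s then deriv_poly F [set i in s] else 0.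
Proof.
elim: s => [|i s IH] /=; first by congr deriv_poly; apply/setP => j; rewrite !inE.
rewrite -/(iter_deriv s _) IH; case: (uniq s); last by rewrite andbF linear0.
rewrite andbT mderiv_deriv_poly inE; case: (i \in s) => //=; congr deriv_poly.
by apply/setP => j; rewrite !inE.
Qed.

Lemma mcoeff0_deriv_poly F S :
  mcoeff mnm0 (deriv_poly F S) = if #|S| == k then F S else 0.
Proof.
rewrite /deriv_poly raddf_sum /=.
have e T : S \subset T -> (mesym1 (T :\: S) == mnm0) = (T == S).
  move=> ST; rewrite -mdeg_eq0 mdeg_mesym1 cards_eq0 setD_eq0.
  by rewrite eqEsubset ST andbT.
case: ifP => Sk.
  rewrite (bigD1 S) ?subxx ?Sk //= big1 => [|T /andP[/andP[ST _] TS]].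
    by rewrite mcoeffZ mcoeffX e // eqxx mulr1 addr0.
  by rewrite mcoeffZ mcoeffX e // (negPf TS) mulr0.
apply: big1 => T /andP[ST /eqP Tk]; rewrite mcoeffZ mcoeffX e //.
by case: eqP => [TS|_]; rewrite ?mulr0 //; rewrite -TS Tk eqxx in Sk.
Qed.

Lemma mcoeff_deriv_poly F m : mcoeff m (deriv_poly F set0) =
  \sum_(T : {set 'I_n} | #|T| == k) F T * (mesym1 T == m)%:R.
Proof.
rewrite /deriv_poly raddf_sum /=.
by apply: eq_big => [T|T _]; rewrite ?sub0set // mcoeffZ mcoeffX setD0.
Qed.

Lemma mcoeff_mesym1 F T : #|T| = k ->
  mcoeff (mesym1 T) (deriv_poly F set0) = F T.
Proof.
move=> Tk; rewrite mcoeff_deriv_poly (bigD1 T) ?Tk //= eqxx mulr1 big1 ?addr0 //.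
by move=> T' /andP[_ /negPf]; rewrite -(inj_eq (@inj_mesym1 n)) => ->; rewrite mulr0.
Qed.

Lemma mcoeff_neq0 F m : mcoeff m (deriv_poly F set0) != 0 ->
  exists T, [/\ #|T| = k, m = mesym1 T & F T != 0].
Proof.
move=> mF; have [T /and3P[/eqP Tk /eqP mT FT]|none] :=
  pickP [pred T : {set 'I_n} | [&& #|T| == k, m == mesym1 T & F T != 0]].
  by exists T.
case/eqP: mF; rewrite mcoeff_deriv_poly big1 // => T Tk.
have := none T; rewrite /= Tk /= eq_sym; case: eqP => //= _; rewrite ?mulr0 //.
by move/negbFE/eqP->; rewrite mul0r.
Qed.

Lemma ksubset_poly_neq0 F T : #|T| = k -> F T != 0 -> ksubset_poly (kvector F) != 0.
Proof.
move=> Tk; rewrite ksubset_polyE; apply: contra_neq => F0.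
by rewrite -(mcoeff_mesym1 F Tk) F0 mcoeff0.
Qed.

Lemma good_limit_lorentzian F : (k <= n)%N -> good_limit k F ->
  lorentzian k (ksubset_poly (kvector F)).
Proof.
move=> kn lF; have F0 := good_limit_ge0 lF; rewrite ksubset_polyE; split.
- apply/dhomogP => m; rewrite mcoeff_msupp => /mcoeff_neq0[T [Tk -> _]].
  by rewrite /= mdeg_mesym1.
- move=> m; have [/eqP->//|/mcoeff_neq0[T [Tk -> _]]] := boolP (mcoeff m (deriv_poly F set0) == 0).
  by rewrite mcoeff_mesym1 // F0.
- have pos T : #|T| = k -> F T != 0 -> 0 < F T by move=> Tk FT; rewrite lt_def FT F0.
  move=> a b; rewrite !mcoeff_msupp => /mcoeff_neq0[A [Ak -> FA]] /mcoeff_neq0[B [Bk -> FB]] i.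
  (* The exponents are 0 or 1, so strict inequality at [i] means [i] in [A] and not in [B]. *)
  rewrite !mnmE => ABi.
  have [iA iB] : i \in A /\ i \notin B by move: ABi; case: (i \in A); case: (i \in B).
  have [j] := good_limit_exchange kn lF Ak Bk (pos _ Ak FA) (pos _ Bk FB) iA iB.
  rewrite inE => /andP[jA jB] Fj; exists j; first by rewrite !mnmE (negPf jA) jB.
  have -> : mnm_add (mnm_sub (mesym1 A) (mnm1 i)) (mnm1 j) = mesym1 (j |: (A :\ i)).
    apply/mnmP => l; rewrite mnmDE mnmBE !mnm1E !mnmE !inE !(eq_sym _ l).
    have [->|lj] := eqVneq l j; first by rewrite (negPf jA).
    by rewrite addn0; have [->|li] /= := eqVneq l i; rewrite ?iA // subn0.
  rewrite mcoeff_msupp mcoeff_mesym1 ?gt_eqF // cardsU1 !inE (negPf jA) andbF add1n.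
  by have := cardsD1 i A; rewrite iA Ak.
- move=> k2 s; rewrite iter_deriv_poly.
  have sk : (size s + 2)%N = k by rewrite size_tuple subnK.
  (* A repeated index annihilates the polynomial, and the zero form is hyperbolic. *)
  have [us|us] := boolP (uniq s); last first.
    apply: hyperbolic_num_pos; first by apply/matrixP => i j; rewrite !mxE !linear0.
    move=> x y; exists 1, 0; rewrite oner_eq0; split=> //.
    rewrite bformE big1 // => i _; rewrite big1 // => j _.
    by rewrite mxE !linear0 !mul0r.
  set S := [set i in _]; have Sk : (#|S| + 2)%N = k by rewrite /S cardsE (card_uniqP us).
  have -> : quad_hessian (deriv_poly F S) = hess k F S.
    apply/matrixP => i j; rewrite !mxE mderiv_deriv_poly.
    case: ifP => iS /=; first by rewrite linear0 /= mcoeff0 andbF.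
    rewrite mderiv_deriv_poly in_setU1; have [ij|ij] /= := eqVneq i j.
      by rewrite mcoeff0.
    case: ifP => jS /=; first by rewrite mcoeff0.
    have c : #|i |: (j |: S)| = k by rewrite -[RHS]Sk addn2 cardsU2 ?iS ?jS.
    by rewrite mcoeff0_deriv_poly setUCA c eqxx psum_card.
  apply: hyperbolic_num_pos; first exact: hess_sym.
  exact: good_limit_hyperbolic Sk.
Qed.

End SubsetPolynomials.

(** * Convergence to the top projection *)

Section EntrywiseNorm.
Variable R : realFieldType.

Definition norm1 m n (M : 'M[R]_(m, n)) : R := \sum_i \sum_j `|M i j|.

Lemma norm1_ge0 m n (M : 'M[R]_(m, n)) : 0 <= norm1 M.
Proof. by apply: sumr_ge0 => i _; apply: sumr_ge0. Qed.

Lemma norm1D m n (M N : 'M[R]_(m, n)) : norm1 (M + N) <= norm1 M + norm1 N.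
Proof.
rewrite -big_split; apply: ler_sum => i _; rewrite -big_split; apply: ler_sum => j _.
by rewrite mxE ler_normD.
Qed.

Lemma norm1Z m n a (M : 'M[R]_(m, n)) : norm1 (a *: M) = `|a| * norm1 M.
Proof.
rewrite mulr_sumr; apply: eq_bigr => i _; rewrite mulr_sumr.
by apply: eq_bigr => j _; rewrite mxE normrM.
Qed.

Lemma norm1M m n p (M : 'M[R]_(m, n)) (N : 'M[R]_(n, p)) :
  norm1 (M *m N) <= norm1 M * norm1 N.
Proof.
rewrite /norm1 mulr_suml; apply: ler_sum => i _.
apply: le_trans (_ : \sum_j \sum_k `|M i k| * `|N k j| <= _).
  apply: ler_sum => j _; rewrite mxE; apply: le_trans (ler_norm_sum _ _ _) _.
  by apply: ler_sum => k _; rewrite normrM.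
rewrite exchange_big mulr_suml; apply: ler_sum => k _ /=.
rewrite -mulr_sumr ler_wpM2l // [leRHS](bigD1 k) //= lerDl.
by apply: sumr_ge0 => l _; apply: sumr_ge0.
Qed.

Lemma norm1_entry m n (M : 'M[R]_(m, n)) i j : `|M i j| <= norm1 M.
Proof.
rewrite /norm1 (bigD1 i) //= (bigD1 j) //= -addrA lerDl addr_ge0 ?sumr_ge0 // => l _.
by apply: sumr_ge0.
Qed.

Lemma norm1_diag n (d : 'rV[R]_n) (x : 'rV[R]_n) : (forall i, `|d 0 i| <= 1) ->
  norm1 (x *m diag_mx d) <= norm1 x.
Proof.
move=> d1; apply: ler_sum => i _; apply: ler_sum => j _.
by rewrite mul_mx_diag mxE normrM ler_piMr // ord1.
Qed.

(** The error obeys [e' <= (1 + eta) e + eta |c|], because the unperturbed orbit never grows; the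
    bound solves this recursion. *)
Lemma perturbed_power n (D E : 'M[R]_n) (c : 'rV[R]_n) eta m :
  (forall x : 'rV_n, norm1 (x *m D) <= norm1 x) -> norm1 E <= eta ->
  norm1 (iter m (mulmx^~ (D + E)) c - iter m (mulmx^~ D) c)
    <= ((1 + eta) ^+ m - 1) * norm1 c.
Proof.
move=> hD hE; have eta0 : 0 <= eta := le_trans (norm1_ge0 E) hE.
have hz l : norm1 (iter l (mulmx^~ D) c) <= norm1 c.
  by elim: l => //= l IH; apply: le_trans (hD _) IH.
elim: m => [|m IH] /=.
  rewrite subrr expr0 subrr mul0r /norm1 !big1 // => i _.
  by rewrite big1 // => j _; rewrite mxE normr0.
set y := iter m _ c in IH *; set z := iter m (mulmx^~ D) c in IH *.
have -> : y *m (D + E) - z *m D = (y - z) *m D + (y - z) *m E + z *m E.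
  by rewrite mulmxDr !mulmxBl; apply/matrixP => i j; rewrite !mxE; ring.
have hm x : norm1 (x *m E) <= eta * norm1 x.
  by apply: le_trans (norm1M _ _) _; rewrite mulrC ler_wpM2r ?norm1_ge0.
apply: le_trans (norm1D _ _) _; apply: le_trans (lerD (norm1D _ _) (lexx _)) _.
have h1 := hD (y - z); have h2 := hm _ (y - z); have h3 := hm _ z.
have h4 : eta * norm1 z <= eta * norm1 c by rewrite ler_wpM2l // hz.
have h5 : (1 + eta) * norm1 (y - z) <= (1 + eta) * (((1 + eta) ^+ m - 1) * norm1 c).
  by rewrite ler_wpM2l // addr_ge0.
rewrite exprS; move: h5; set t := (1 + eta) ^+ m; lra.
Qed.

Lemma pow1D_le (eta : R) m : 0 <= eta -> m%:R * eta <= 2^-1 ->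
  (1 + eta) ^+ m - 1 <= 2 * (m%:R * eta).
Proof.
move=> eta0 hm; have e1 : 0 <= 1 + eta by rewrite addr_ge0.
have : (1 + eta) ^+ m * (1 - m%:R * eta) <= 1.
  elim: m {hm} => [|m IH]; first by rewrite expr0 mul0r subr0 mul1r.
  apply: le_trans IH; rewrite exprSr -mulrA ler_wpM2l ?exprn_ge0 //.
  rewrite -natr1; have : 0 <= m%:R :> R by []; nra.
have : 1 <= (1 + eta) ^+ m by rewrite exprn_ege1 // lerDl.
move: hm; set u := m%:R * eta; set a := _ ^+ m => hu ha h.
have : 0 <= u by rewrite mulr_ge0.
nra.
Qed.

(** Decay like [1 / (1 + m del)] replaces exponential decay and suffices once [m del] tends to
    infinity. *)
Lemma pow1B_le (del : R) m : 0 <= del <= 1 -> (1 - del) ^+ m * (1 + m%:R * del) <= 1.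
Proof.
case/andP=> d0 d1; elim: m => [|m IH]; first by rewrite expr0 mul0r addr0 mul1r.
apply: le_trans IH; rewrite exprSr -mulrA ler_wpM2l ?exprn_ge0 ?subr_ge0 //.
rewrite -natr1; have : 0 <= m%:R :> R by []; nra.
Qed.

End EntrywiseNorm.

(** * Edge operators as matrices on token configurations *)

Section TokenOperators.
Variables (R : realType) (n k : nat).
Hypothesis k_le_n : (k <= n)%N.
Variables (E : {set {set 'I_n}}) (w : {set 'I_n} -> R) (theta : R).
Hypothesis E2 : forall e, e \in E -> #|e| = 2%N.
Hypothesis w_ge0 : forall e, e \in E -> 0 <= w e.
Hypothesis theta_bound : -1 <= theta <= 1.
Implicit Types (F : {set 'I_n} -> R) (S T : {set 'I_n}).

Lemma symdiffC S T : symdiff S T = symdiff T S.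
Proof. by rewrite /symdiff setUC. Qed.

Lemma symdiff_eq S T (e : {set 'I_n}) : (symdiff S T == e) = (S == symdiff T e).
Proof.
apply/eqP/eqP => [<-|->]; apply/setP => i; rewrite !inE;
  by case: (i \in S); case: (i \in T); case: (i \in e).
Qed.

(** Because [|symdiff T e| = |T| + 2 - 2 |T :&: e|]. Hence adjacency along [e] only joins sets that
    [e] meets in one point. *)
Lemma card_symdiff_inter S T (e : {set 'I_n}) : #|S| = #|T| -> #|e| = 2%N -> S = symdiff T e ->
  #|T :&: e| = 1%N.
Proof.
move=> ST e2 SE; move: ST; rewrite SE /symdiff cardsU.
have -> : (T :\: e) :&: (e :\: T) = set0.
  by apply/setP => i; rewrite !inE; case: (i \in e); case: (i \in T).
rewrite cards0 subn0 !cardsD (setIC e) e2.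
have := subset_leq_card (subsetIl T e); have := subset_leq_card (subsetIr T e).
rewrite e2; move: #|T :&: e| #|T| => c t.
case: c => [|[|[|c]]] //; first by rewrite !subn0 => _ _ /eqP; rewrite -[X in _ == X]addn0 eqn_add2l.
by move=> _ h /eqP; rewrite addn0 -[X in _ == X](subnK h) -[X in X == _]addn0 eqn_add2l.
Qed.

Lemma token_H_sym : (token_H E w k theta)^T = token_H E w k theta.
Proof.
rewrite /token_H linearD linearZ /= /token_deg tr_diag_mx; congr (_ + _).
by apply/matrixP => a b; rewrite !mxE symdiffC.
Qed.

Lemma token_H_sum : token_H E w k theta = \sum_(e in E) token_H [set e] w k theta.
Proof.
apply/matrixP => a b; rewrite summxE /token_H !mxE /=.
under [RHS]eq_bigr do rewrite !mxE /= in_set1.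
rewrite big_split /=; congr (_ + _); last first.
  rewrite -mulr_sumr; congr (_ * _); case: (a == b); last first.
    by rewrite mulr0n big1 // => e _; rewrite mulr0n.
  rewrite mulr1n big_mkcondr; apply: eq_bigr => e _; rewrite mulr1n.
  by rewrite big_mkcondr big_set1.
set s := symdiff _ _; case: ifP => sE.
  rewrite (bigD1 s) //= eqxx big1 ?addr0 // => e /andP[_ /negPf].
  by rewrite eq_sym => ->.
by rewrite big1 // => e eE; case: eqP => // se; rewrite se eE in sE.
Qed.

Lemma ksub_inj : injective (@ksub n k).
Proof. exact: enum_val_inj. Qed.

Lemma ksub_surj T : #|T| = k -> exists a : 'I_#|ksubsets n k|, ksub a = T.
Proof.
move=> Tk; have TK : T \in ksubsets n k by rewrite inE Tk.
by exists (enum_rank_in TK T); rewrite /ksub enum_rankK_in.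
Qed.

(** The column of a set [S] has an adjacency entry only at [symdiff S e], which has size [k] exactly
    when [e] meets [S] once; the degree term is nonzero under the same condition only. *)
Lemma edge_op_matrix e F eps : e \in E ->
  kvector k F *m (1%:M + eps *: token_H [set e] w k theta) =
  kvector k (edge_op e (1 + eps * theta * w e) (eps * w e) F).
Proof.
move=> eE; apply/rowP => b; rewrite mulmxDr mulmx1 -scalemxAr; do 4![rewrite mxE].
have adj : \sum_a kvector k F 0 a * token_H [set e] w k theta a b =
   (if #|ksub b :&: e| == 1%N then w e * F (symdiff (ksub b) e) else 0) +
   theta * (if #|ksub b :&: e| == 1%N then w e else 0) * F (ksub b).
  under eq_bigr do rewrite !mxE /= in_set1 mulrDr.
  rewrite big_split /=; congr (_ + _); last first.
    rewrite (bigD1 b) //= eqxx mulr1n [X in _ + X]big1 ?addr0 => [|a ab]; last first.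
      by rewrite (negPf ab) mulr0n !mulr0.
    by rewrite big_mkcondr big_set1 mulrC.
  case: ifP => be; last first.
    rewrite big1 // => a _; case: eqP => [se|_]; last by rewrite mulr0.
    case/eqP: be; apply: (card_symdiff_inter (S := ksub a)); rewrite ?card_ksub ?E2 //.
    by apply/eqP; rewrite -symdiff_eq se.
  have [a0 a0E] : exists a0 : 'I_#|ksubsets n k|, ksub a0 = symdiff (ksub b) e.
    by apply: ksub_surj; rewrite (card_symdiff (E2 eE)) ?card_ksub // (eqP be).
  rewrite (bigD1 a0) //= symdiff_eq a0E eqxx big1 ?addr0 => [|a aa0].
    by rewrite mulrC; congr (w _ * _); apply/eqP; rewrite symdiff_eq.
  by rewrite symdiff_eq -a0E (inj_eq ksub_inj) (negPf aa0) mulr0.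
rewrite adj [RHS]mxE /edge_op; case: ifP => _; ring.
Qed.

(** The extra 1 makes [W] strictly larger than each weight, so [eps W <= 1] keeps
    [1 + eps theta w_e] positive even at [theta = -1]. *)
Let W := 1 + \sum_(e in E) w e.

Let w_lt e : e \in E -> w e < W.
Proof.
move=> eE; rewrite /W (bigD1 e) //= addrCA ltrDl ltr_pwDl //.
by apply: sumr_ge0 => f /andP[/w_ge0].
Qed.

Lemma good_edge_step e F eps : e \in E -> 0 <= eps -> eps * W <= 1 -> good k F ->
  good k (edge_op e (1 + eps * theta * w e) (eps * w e) F).
Proof.
move=> eE eps0 epsW gF; have w0 := w_ge0 eE.
have b0 : 0 <= eps * w e by rewrite mulr_ge0.
have b1 : eps * w e < 1.
  move: eps0; rewrite le_eqVlt => /orP[/eqP<-|eps0]; first by rewrite mul0r.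
  by apply: lt_le_trans epsW; rewrite ltr_pM2l ?w_lt.
have [t1 t2] := andP theta_bound.
rewrite -mulrA mulrCA; move: (eps * w e) b0 b1 => b b0 b1.
have tb1 : theta * b <= b by rewrite -[leRHS]mul1r ler_wpM2r.
have tb2 : - b <= theta * b by rewrite -mulN1r ler_wpM2r.
move: (theta * b) tb1 tb2 => tb tb1 tb2.
apply: edge_op_good; rewrite ?E2 //.
- by lra.
- by apply: exprn_ege1; lra.
- rewrite -(real_normK (num_real _)) expr_le1 // ler_norml.
  by apply/andP; split; lra.
Qed.

Definition edge_prod eps (L : seq {set 'I_n}) : 'M[R]_#|ksubsets n k| :=
  foldr (fun e M => (1%:M + eps *: token_H [set e] w k theta) *m M) 1%:M L.

Lemma good_edge_prod L F eps : {subset L <= E} -> 0 <= eps -> eps * W <= 1 ->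
  good k F -> exists2 F', good k F' & kvector k F' = kvector k F *m edge_prod eps L.
Proof.
move=> LE eps0 epsW; elim: L F LE => [|e L IH] F LE gF /=.
  by exists F; rewrite // mulmx1.
have eE : e \in E by apply: LE; rewrite inE eqxx.
have LE' : {subset L <= E} by move=> f fL; apply: LE; rewrite inE fL orbT.
have [F' gF' F'E] := IH _ LE' (good_edge_step eE eps0 epsW gF).
by exists F'; rewrite // F'E -edge_op_matrix // mulmxA.
Qed.

(** The order of the factors matters only from [eps^2] on; [eps <= 1] absorbs higher powers, so [K]
    is independent of [eps]. *)
Lemma edge_prod_expand L : exists2 K, 0 <= K & forall eps, 0 <= eps <= 1 ->
  norm1 (edge_prod eps L - (1%:M + eps *: \sum_(e <- L) token_H [set e] w k theta))
  <= K * eps ^+ 2.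
Proof.
elim: L => [|e L [K K0 IH]].
  exists 0 => // eps _; rewrite big_nil scaler0 addr0 subrr mul0r.
  by rewrite /norm1 big1 // => i _; rewrite big1 // => j _; rewrite mxE normr0.
set He := token_H [set e] w k theta; set Sg := \sum_(e <- L) _ in IH.
exists (norm1 (He *m Sg) + K + norm1 He * K).
  by rewrite !addr_ge0 ?mulr_ge0 ?norm1_ge0.
move=> eps /andP[e0 e1]; rewrite big_cons -/Sg -/He /= -/He.
have := IH eps; rewrite e0 e1 => /(_ isT).
set Q := edge_prod eps L; set rho := Q - _ => hrho.
have -> : (1%:M + eps *: He) *m Q - (1%:M + eps *: (He + Sg)) =
   eps ^+ 2 *: (He *m Sg) + rho + eps *: (He *m rho).
  rewrite /rho mulmxBr mulmxDr mulmx1 mulmxDl mul1mx -scalemxAl -scalemxAr.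
  by apply/matrixP => i j; rewrite !mxE; ring.
apply: le_trans (norm1D _ _) _; apply: le_trans (lerD (norm1D _ _) (lexx _)) _.
rewrite !norm1Z ger0_norm ?sqr_ge0 // ger0_norm //.
have h1 : norm1 (He *m rho) <= norm1 He * (K * eps ^+ 2).
  by apply: le_trans (norm1M _ _) _; rewrite ler_wpM2l ?norm1_ge0.
have h2 : eps * norm1 (He *m rho) <= norm1 He * (K * eps ^+ 2).
  by apply: le_trans h1; rewrite ler_piMl ?norm1_ge0.
by rewrite !mulrDl; apply: lerD; [rewrite mulrC lerD2l|rewrite -mulrA].
Qed.

(** For the elementary symmetric polynomial the form is [(sum y)^2 - sum y^2] over the complement of
    [S], nonpositive where the sum vanishes. *)
Lemma good_const1 : good k (fun _ : {set 'I_n} => 1 : R).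
Proof.
split=> // S Sk; apply: (@hyperbolic_functional _ _ _ (\row_i (i \notin S)%:R)) => y y0.
have -> : bform (hess k (fun _ : {set 'I_n} => 1) S) y y =
    dotv (\row_i (i \notin S)%:R) y ^+ 2 - \sum_i (i \notin S)%:R * y 0 i ^+ 2.
  rewrite bformE expr2 /dotv mulr_suml -sumrB; apply: eq_bigr => i _.
  rewrite mulr_sumr (bigD1 i) //= [in RHS](bigD1 i) //= !mxE eqxx /= !mul0r add0r.
  rewrite addrAC; have -> : (i \notin S)%:R * y 0 i * ((i \notin S)%:R * y 0 i) -
     (i \notin S)%:R * y 0 i ^+ 2 = 0 by case: (i \notin S); rewrite /=; ring.
  rewrite add0r; apply: eq_bigr => j ji; rewrite !mxE eq_sym ji /=.
  have [iS|iS] /= := boolP (i \in S); first by rewrite !mul0r.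
  have [jS|jS] /= := boolP (j \in S); first by rewrite !(mul0r, mulr0).
  by rewrite psum_card ?mul1r // cardsU2 ?iS ?jS 1?eq_sym // -Sk addn2.
rewrite y0 expr0n sub0r oppr_le0; apply: sumr_ge0 => i _.
by rewrite mulr_ge0 ?sqr_ge0.
Qed.

End TokenOperators.

(** * Error and decay estimates for repeated sweeps *)

Section Convergence.
Variables (R : realType) (n k : nat).
Hypothesis k_le_n : (k <= n)%N.
Variables (E : {set {set 'I_n}}) (w : {set 'I_n} -> R) (theta : R).
Hypothesis E2 : forall e, e \in E -> #|e| = 2%N.
Hypothesis w_ge0 : forall e, e \in E -> 0 <= w e.
Hypothesis theta_bound : -1 <= theta <= 1.

Let H := token_H E w k theta.
Let lam := top_eigenvalue H.
Let N := #|ksubsets n k|.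
Variables (P : 'M[R]_N) (d : 'rV[R]_N).
Hypothesis PdH : diagonalizes P d H.

Let c : 'rV[R]_N := const_mx 1 *m P^T.
Let t : 'rV[R]_N := \row_i (if d 0 i == lam then c 0 i else 0).

Let le_lam i : d 0 i <= lam. Proof. exact: le_top_eigenvalue PdH. Qed.

(* One sweep over the edges, [Q], agrees with [1 + eps H] up to order [eps^2];
   normalized by [s], [1 + eps H] is a contraction in the eigenbasis. *)
Let sweep_error (eps K s : R) (Q : 'M[R]_N) (m : nat) i :
  0 < eps -> (0 < m)%N -> s = 1 + eps * lam -> 2^-1 <= s <= 2 ->
  (forall j, 0 <= 1 + eps * d 0 j) -> 0 <= K ->
  norm1 (Q - (1%:M + eps *: H)) <= K * eps ^+ 2 ->
  let eta := 2 * norm1 P * norm1 P^T * K * eps ^+ 2 in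
  m%:R * eta <= 2^-1 ->
  `|(iter m (mulmx^~ (s^-1 *: Q)) (const_mx 1) *m P^T - t) 0 i|
  <= 2 * (m%:R * eta) * norm1 c +
     (if d 0 i == lam then 0 else norm1 c / (m%:R * eps * (lam - d 0 i) / 2)).
Proof.
move=> eps_gt0 m_gt0 sE /andP[s1 s2] d0 K0 hQ eta hm.
have eps0 := ltW eps_gt0.
have s0 : 0 < s by apply: lt_le_trans s1; rewrite invr_gt0.
have [PP HE] := PdH.
pose D : 'rV[R]_N := \row_j ((1 + eps * d 0 j) / s).
have D01 j : 0 <= D 0 j <= 1.
  rewrite mxE divr_ge0 ?d0 ?(ltW s0) //= ler_pdivrMr // mul1r sE lerD2l.
  by rewrite ler_wpM2l.
pose X := P *m (s^-1 *: Q) *m P^T - diag_mx D.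
have XE : X = s^-1 *: (P *m (Q - (1%:M + eps *: H)) *m P^T).
  rewrite mulmxBr mulmxBl scalerBr /X -scalemxAr -scalemxAl; congr (_ - _).
  rewrite mulmxDr mulmxDl mulmx1 PP -scalemxAr -scalemxAl.
  rewrite HE !mulmxA PP mul1mx -mulmxA PP mulmx1.
  apply/matrixP => a b; rewrite !mxE; case: (a == b); last by rewrite !mulr0n mulr0 addr0 mulr0.
  by rewrite !mulr1n mulrC.
have eta0 : 0 <= eta by rewrite !mulr_ge0 ?norm1_ge0 ?sqr_ge0.
have hX : norm1 X <= eta.
  rewrite XE norm1Z ger0_norm ?invr_ge0 ?(ltW s0) //.
  have h1 : norm1 (P *m (Q - (1%:M + eps *: H)) *m P^T) <=
      norm1 P * (K * eps ^+ 2) * norm1 P^T.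
    apply: le_trans (norm1M _ _) _; rewrite ler_wpM2r ?norm1_ge0 //.
    by apply: le_trans (norm1M _ _) _; rewrite ler_wpM2l ?norm1_ge0.
  have h2 : s^-1 <= 2 by rewrite -[leRHS]invrK lef_pV2 ?posrE ?invr_gt0.
  apply: le_trans (ler_pM _ (norm1_ge0 _) h2 h1) _; rewrite ?invr_ge0 ?(ltW s0) //.
  by rewrite /eta le_eqVlt; apply/orP; left; apply/eqP; ring.
have itX : iter m (mulmx^~ (s^-1 *: Q)) (const_mx 1) *m P^T =
    iter m (mulmx^~ (diag_mx D + X)) c.
  elim: (m) => //= l <-; rewrite /X addrC subrK !mulmxA; congr (_ *m _).
  by rewrite -[in RHS](mulmxA _ P^T P) (mulmx1C PP) mulmx1.
have itD l : (iter l (mulmx^~ (diag_mx D)) c) 0 i = D 0 i ^+ l * c 0 i.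
  elim: l => [|l IH] /=; first by rewrite expr0 mul1r.
  by rewrite mul_mx_diag mxE IH exprS; ring.
have D1 x : norm1 (x *m diag_mx D : 'rV_N) <= norm1 (x : 'rV_N).
  apply: norm1_diag => j; have /andP[D0 D1] := D01 j.
  by rewrite ger0_norm.
have pp := perturbed_power c m D1 hX.
have pw := pow1D_le eta0 hm.
have sub (x y : 'rV[R]_N) : (x - y) 0 i = x 0 i - y 0 i by rewrite !mxE.
rewrite sub itX.
have -> : (iter m (mulmx^~ (diag_mx D + X)) c) 0 i - t 0 i =
  (iter m (mulmx^~ (diag_mx D + X)) c - iter m (mulmx^~ (diag_mx D)) c) 0 i
   + (D 0 i ^+ m * c 0 i - t 0 i).
  by rewrite sub itD; ring.
apply: le_trans (ler_normD _ _) (lerD _ _).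
  apply: le_trans (norm1_entry _ _ _) (le_trans pp _).
  by rewrite ler_wpM2r ?norm1_ge0.
rewrite [t 0 i]mxE; have [dl|dl] := eqVneq (d 0 i) lam.
  by rewrite mxE dl -sE divff ?gt_eqF // expr1n mul1r subrr normr0.
have ld : 0 < lam - d 0 i by rewrite subr_gt0 lt_def eq_sym dl le_lam.
have /andP[Di0 Di1] := D01 i.
rewrite subr0 normrM ger0_norm ?exprn_ge0 // mulrC.
apply: ler_pM; rewrite ?exprn_ge0 //; first exact: norm1_entry.
pose del := 1 - D 0 i.
have del01 : 0 <= del <= 1 by rewrite subr_ge0 Di1 /= lerBlDr lerDl.
have := pow1B_le m del01; rewrite /del subKr -/del => h.
have delE : del = eps * (lam - d 0 i) / s.
  by rewrite /del mxE sE; field; rewrite -sE gt_eqF.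
(* The divisor 2 bounds [s], so [g <= m del]. *)
set g := m%:R * eps * (lam - d 0 i) / 2.
have g0 : 0 < g by rewrite /g !mulr_gt0 ?ltr0n ?invr_gt0.
have gdel : g <= m%:R * del.
  rewrite delE !mulrA ler_pM2l ?mulr_gt0 ?ltr0n //.
  by rewrite lef_pV2 ?posrE.
rewrite -(ler_pM2r g0) mulVf ?gt_eqF //; apply: le_trans h.
by rewrite ler_wpM2l ?exprn_ge0 // (le_trans gdel) // lerDr.
Qed.

Lemma token_sweep_approx delta : 0 < delta ->
  exists2 F, good k F & forall a,
    `|F (ksub a) - ((const_mx 1 : 'rV_N) *m orth_proj (top_eigenspace H)) 0 a| < delta.
Proof.
move=> delta0; have [PP HE] := PdH.
have [K K0 hK] := edge_prod_expand k w theta (enum E).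
pose Kp := 2 * norm1 P * norm1 P^T * K.
have Kp0 : 0 <= Kp by rewrite !mulr_ge0 ?norm1_ge0.
pose W := 1 + \sum_(e in E) w e.
have W0 : 0 <= W by rewrite addr_ge0 // sumr_ge0.
pose g i := if d 0 i == lam then 0 else norm1 c / ((lam - d 0 i) / 2).
have g0 i : 0 <= g i.
  rewrite /g; case: ifP => // _; rewrite divr_ge0 ?norm1_ge0 // divr_ge0 //.
  by rewrite subr_ge0.
pose G := \sum_(i < N) (2 * Kp * norm1 c + g i).
have G0 : 0 <= G by apply: sumr_ge0 => i _; rewrite addr_ge0 // !mulr_ge0 ?norm1_ge0.
pose B := G * norm1 P / delta.
have B0 : 0 <= B by rewrite divr_ge0 ?mulr_ge0 ?norm1_ge0 // ltW.
pose Dn := \sum_i `|d 0 i|; have Dn0 : 0 <= Dn by apply: sumr_ge0.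
(* Each summand is one demand on [r = 1/q < 1/Z], or on [eps <= r]: [W] for the edge steps,
   [2 |lam|] for [s] between 1/2 and 2, [Dn] for [1 + eps d_j >= 0], [2 Kp] for [m eta <= 1/2], and
   [B] for the final bound by [delta]. *)
pose Z := 1 + W + 2 * `|lam| + Dn + 2 * Kp + B.
have l0 : 0 <= `|lam| by [].
have Z0 : 0 <= Z by rewrite /Z; lra.
pose q := Num.bound Z; have hq : Z < q%:R := archi_boundP Z0.
have q1 : 1 < q%:R :> R by apply: le_lt_trans hq; rewrite /Z; lra.
pose r : R := q%:R^-1.
have q0 : 0 < q%:R :> R by apply: lt_trans q1.
have r0 : 0 < r by rewrite invr_gt0.
have rq : r * q%:R = 1 by rewrite mulVf // gt_eqF.
have rZ : r * Z < 1 by rewrite -rq ltr_pM2l.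
have rpart x : 0 <= x -> x <= Z -> r * x <= 1.
  by move=> x0 xZ; apply: le_trans (ltW rZ); rewrite ler_pM2l.
have r1 : r <= 1 by rewrite -[r]mulr1; apply: rpart => //; rewrite /Z; lra.
pose eps := r ^+ 2; have eps_gt0 : 0 < eps by rewrite exprn_gt0.
have epsr : eps <= r by rewrite /eps expr2 ler_piMl // ltW.
pose m := (q ^ 3)%N; have m0 : (0 < m)%N by rewrite expn_gt0 -(ltr0n R) q0.
have mE : m%:R = q%:R ^+ 3 :> R by rewrite natrX.
have meps : m%:R * eps = q%:R.
  transitivity ((r * q%:R) ^+ 2 * q%:R); first by rewrite mE /eps; ring.
  by rewrite rq expr1n mul1r.
have epspart x : 0 <= x -> x <= Z -> eps * x <= 1.
  by move=> x0 xZ; apply: le_trans (rpart x x0 xZ); rewrite ler_wpM2r.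
have epsW : eps * W <= 1 by apply: epspart => //; rewrite /Z; lra.
have epsl : eps * `|lam| <= 2^-1.
  have : eps * (2 * `|lam|) <= 1 by apply: epspart; rewrite ?mulr_ge0 // /Z; lra.
  lra.
pose s := 1 + eps * lam.
have s12 : 2^-1 <= s <= 2.
  have : `|eps * lam| <= 2^-1 by rewrite normrM ger0_norm // ltW.
  by rewrite ler_norml /s => /andP[? ?]; apply/andP; split; lra.
have s0 : 0 < s by case/andP: s12 => s1 _; apply: lt_le_trans s1; rewrite invr_gt0.
have d0 j : 0 <= 1 + eps * d 0 j.
  have dj : `|d 0 j| <= Dn by rewrite /Dn (bigD1 j) //= lerDl sumr_ge0.
  have : eps * `|d 0 j| <= 1 by apply: epspart => //; rewrite /Z; lra.
  rewrite -[X in X * _]ger0_norm ?(ltW eps_gt0) // -normrM ler_norml => /andP[? _].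
  by lra.
pose Q := edge_prod k w theta eps (enum E).
have hQ : norm1 (Q - (1%:M + eps *: H)) <= K * eps ^+ 2.
  rewrite /H token_H_sum -big_enum /=; apply: hK.
  by rewrite (ltW eps_gt0) (le_trans epsr).
have meta : m%:R * (Kp * eps ^+ 2) = Kp * r.
  transitivity ((r * q%:R) ^+ 3 * (Kp * r)); first by rewrite mE /eps; ring.
  by rewrite rq expr1n mul1r.
have hm : m%:R * (Kp * eps ^+ 2) <= 2^-1.
  rewrite meta; have : r * (2 * Kp) <= 1 by apply: rpart; [exact: mulr_ge0|rewrite /Z; lra].
  by move=> h; rewrite -(@ler_pM2l _ 2) ?ltr0n // mulfV ?pnatr_eq0 // mulrA mulrC.
have [F gF FE] : exists2 F, good k F &
    kvector k F = iter m (mulmx^~ (s^-1 *: Q)) (const_mx 1 : 'rV_N).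
  elim: (m) => [|l [F gF FE]] /=.
    exists (fun _ : {set 'I_n} => 1 : R); first exact: good_const1.
    by apply/rowP => a; rewrite !mxE.
  have LE : {subset enum E <= E} by move=> e; rewrite mem_enum.
  have [F' gF' F'E] := good_edge_prod k_le_n E2 w_ge0 theta_bound LE (ltW eps_gt0) epsW gF.
  exists (fun T => s^-1 * F' T); first by apply: good_pos_scale; rewrite ?invr_gt0.
  rewrite -FE -scalemxAr -F'E; apply/rowP => a; by rewrite !mxE.
exists F => // a.
have Fa : F (ksub a) = kvector k F 0 a by rewrite mxE.
pose y : 'rV[R]_N := iter m (mulmx^~ (s^-1 *: Q)) (const_mx 1) *m P^T.
have yP : kvector k F = y *m P by rewrite FE /y -mulmxA (mulmx1C PP) mulmx1.
have tP : (const_mx 1 : 'rV_N) *m orth_proj (top_eigenspace H) = t *m P.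
  by rewrite (orth_proj_diag _ PdH).
have sub (x z : 'rV[R]_N) : x 0 a - z 0 a = (x - z) 0 a by rewrite !mxE.
rewrite Fa yP tP sub -mulmxBl.
apply: le_lt_trans (norm1_entry _ _ _) _; apply: le_lt_trans (norm1M _ _) _.
have yt : norm1 (y - t) <= r * G.
  rewrite /norm1 big_ord_recl big_ord0 addr0 /G mulr_sumr; apply: ler_sum => i _.
  have -> : ord0 = 0 :> 'I_1 by [].
  apply: le_trans (sweep_error i eps_gt0 m0 erefl s12 d0 K0 hQ hm) _.
  rewrite /= -/Kp meta [leRHS]mulrDr; apply: lerD.
    by rewrite le_eqVlt; apply/orP; left; apply/eqP; ring.
  rewrite /g; case: ifP => [_|/negbT dl]; first by rewrite mulr0.
  have : lam - d 0 i != 0 by rewrite subr_eq0 eq_sym.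
  rewrite meps /r; move: (lam - d 0 i) => z z0.
  rewrite le_eqVlt; apply/orP; left; apply/eqP; field.
  by rewrite z0 gt_eqF.
apply: le_lt_trans (_ : r * G * norm1 P < delta).
  by rewrite ler_wpM2r ?norm1_ge0.
have : r * B < 1.
  by apply: le_lt_trans rZ; rewrite ler_pM2l // /Z; lra.
by rewrite /B mulrA ltr_pdivrMr // mul1r mulrA.
Qed.

End Convergence.

(** * Nonnegative top eigenvectors *)

Section Perron.
Variables (R : rcfType) (N : nat) (H : 'M[R]_N).
Hypothesis Hsym : H^T = H.

(** Absolute values keep the norm and do not lower the form: diagonal terms, of either sign, involve
    only squares. So the maximum of the Rayleigh quotient is still attained, which kills all
    coordinates below the top. *)
Lemma top_eigenspace_abs (u : 'rV[R]_N) : (forall a b, a != b -> 0 <= H a b) ->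
  (u <= top_eigenspace H)%MS -> (\row_a `|u 0 a| <= top_eigenspace H)%MS.
Proof.
move=> H0 uU; have [P [d PdH]] := real_spectral Hsym.
set v := \row_a _; set lam := top_eigenvalue H.
have uu : bform H u u = lam * dotv u u.
  by move/eigenspaceP: uU => uH; rewrite /bform uH dotvZl.
have vv : dotv v v = dotv u u.
  by apply: eq_bigr => a _; rewrite !mxE -normrM ger0_norm // -expr2 sqr_ge0.
have le_uv : bform H u u <= bform H v v.
  rewrite !bformE; apply: ler_sum => a _; apply: ler_sum => b _; rewrite !mxE.
  have [->|ab] := eqVneq a b.
    by rewrite -!mulrA -normrM ger0_norm // -expr2 sqr_ge0.
  by rewrite -!mulrA ler_wpM2l ?H0 // -normrM ler_norm.
have e : \sum_i (lam - d 0 i) * ((v *m P^T) 0 i * (v *m P^T) 0 i) <= 0.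
  under eq_bigr do rewrite mulrBl.
  rewrite sumrB -mulr_sumr -(dotv_diag _ _ PdH) vv -uu.
  under [X in _ - X]eq_bigr do rewrite mulrA.
  by rewrite -(bform_diag _ _ PdH) subr_le0.
have ge0 i : 0 <= (lam - d 0 i) * ((v *m P^T) 0 i * (v *m P^T) 0 i).
  by rewrite mulr_ge0 ?subr_ge0 ?(le_top_eigenvalue i PdH) // -expr2 sqr_ge0.
rewrite (sub_top_eigenspace _ PdH); apply/forallP => i; apply/implyP => di.
have : \sum_i (lam - d 0 i) * ((v *m P^T) 0 i * (v *m P^T) 0 i) == 0.
  by rewrite eq_le e sumr_ge0.
rewrite psumr_eq0 // => /allP/(_ i); rewrite mem_index_enum => /(_ isT)/=.
by rewrite mulf_eq0 subr_eq0 eq_sym (negPf di) mulf_eq0 orbb.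
Qed.

Lemma ex_top_eigenvector : (0 < N)%N -> (forall a b, a != b -> 0 <= H a b) ->
  exists u : 'rV[R]_N, [/\ u != 0, forall a, 0 <= u 0 a & (u <= top_eigenspace H)%MS].
Proof.
move=> N0 H0; have [P [d PdH]] := real_spectral Hsym.
have [i di] := ex_top_eigenvalue N0 PdH.
exists (\row_a `|row i P 0 a|); split.
- apply/eqP => u0; have : row i P = 0.
    by apply/rowP => a; have /rowP/(_ a) := u0; rewrite [LHS]mxE [RHS]mxE => /normr0P/eqP ->; rewrite mxE.
  have := bform_rows i i PdH; have := dotv_diag (row i P) (row i P) PdH.
  move=> + _ r0; rewrite (row_diag i PdH) r0 => /eqP.
  rewrite (_ : dotv 0 0 = 0); last by apply/eqP; rewrite dotv_eq0.
  rewrite (bigD1 i) //= big1 => [|j ji]; last by rewrite mxE (negPf ji) andbF mul0r.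
  by rewrite mxE !eqxx mulr1 addr0 eq_sym oner_eq0.
- by move=> a; rewrite mxE.
- apply: top_eigenspace_abs => //; apply/eigenspaceP.
  by rewrite (row_eigen i PdH) di.
Qed.

Lemma dotv_orth_proj (x u : 'rV[R]_N) : (u <= top_eigenspace H)%MS ->
  dotv (x *m orth_proj (top_eigenspace H)) u = dotv x u.
Proof.
have [P [d PdH]] := real_spectral Hsym.
rewrite (sub_top_eigenspace _ PdH) => /forallP uU.
rewrite (orth_proj_diag _ PdH) !(dotv_diag _ _ PdH) -mulmxA (proj1 PdH) mulmx1.
apply: eq_bigr => i _; rewrite [X in X * _]mxE.
by have := uU i; case: eqVneq => //= _ /eqP ->; rewrite !mulr0.
Qed.

Lemma orth_proj_sub (x : 'rV[R]_N) :
  (x *m orth_proj (top_eigenspace H) <= top_eigenspace H)%MS.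
Proof. exact: proj_mx_sub. Qed.

End Perron.

(** * The projected all-ones vector as a limit, and the conclusion *)

Section TopProjection.
Variables (R : realType) (n k : nat).

Lemma good_limit_approx (X : {set 'I_n} -> R) :
  (forall delta, 0 < delta -> exists2 F, good k F &
     forall T : {set 'I_n}, #|T| = k -> `|F T - X T| < delta) -> good_limit k X.
Proof.
move=> h; have h' (N : nat) : exists F : {set 'I_n} -> R, good k F /\
    forall T : {set 'I_n}, #|T| = k -> `|F T - X T| < N.+1%:R^-1.
  have [|F gF FX] := h N.+1%:R^-1; first by rewrite invr_gt0 ltr0n.
  by exists F.
have [F hF] := choice h'; exists F => [N|T Tk]; first exact: (proj1 (hF N)).
apply/cvgrPdist_lt => _/posnumP[e]; near=> N; rewrite distrC.
apply: lt_trans (proj2 (hF N) T Tk) _.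
by near: N; exact: near_infty_natSinv_lt.
Unshelve. all: by end_near. Qed.

Lemma good_limit_scale (X : {set 'I_n} -> R) c : 0 < c -> good_limit k X ->
  good_limit k (fun T => c * X T).
Proof.
move=> c0 [F gF FX]; exists (fun N T => c * F N T) => [N|T Tk].
  exact: good_pos_scale.
by apply: cvgM; [exact: cvg_cst|exact: FX].
Qed.

(** The sum has at most one term; it extends [x] by zero to all sets without a partial inverse of
    [ksub]. *)
Definition coef_of (x : 'rV[R]_#|ksubsets n k|) (T : {set 'I_n}) : R :=
  \sum_(a | ksub a == T) x 0 a.

Lemma coef_ofE x a : coef_of x (ksub a) = x 0 a.
Proof.
rewrite /coef_of (bigD1 a) //= big1 ?addr0 // => b /andP[/eqP/ksub_inj ->].
by rewrite eqxx.
Qed.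

Lemma kvector_coef_of x : kvector k (coef_of x) = x.
Proof. by apply/rowP => a; rewrite mxE coef_ofE. Qed.

Lemma token_top_projection (k_le_n : (k <= n)%N) (E : {set {set 'I_n}})
    (w : {set 'I_n} -> R) (theta : R) :
  (forall e, e \in E -> #|e| = 2%N) -> (forall e, e \in E -> 0 <= w e) ->
  -1 <= theta <= 1 ->
  good_limit k (coef_of (const_mx 1 *m
    orth_proj (top_eigenspace (token_H E w k theta)))).
Proof.
move=> E2 w0 th; have [P [d PdH]] := real_spectral (token_H_sym k E w theta).
apply: good_limit_approx => delta delta0.
have [F gF FX] := token_sweep_approx k_le_n E2 w0 th PdH delta0.
exists F => // T /ksub_surj[a <-]; rewrite coef_ofE; exact: FX.
Qed.

End TopProjection.

Theorem corollary7p1 (R : realType) (n k : nat) (hk : (k <= n)%N)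
    (E : {set {set 'I_n}}) (hE : forall e, e \in E -> #|e| = 2%N)
    (w : {set 'I_n} -> R) (hw : forall e, e \in E -> 0 <= w e)
    (theta : R) (htheta : -1 <= theta <= 1) :
  let U := top_eigenspace (token_H E w k theta) in
  let p := ksubset_poly (const_mx 1 *m orth_proj U) in
  [/\ p != 0,
      lorentzian k p &
      \rank U = 1%N ->
      [/\ exists q, perron_spans U q,
          forall q q', perron_spans U q -> perron_spans U q' ->
            exists2 c, 0 < c & q' = c *: q &
          forall q, perron_spans U q -> lorentzian k (ksubset_poly q)]].
Proof.
move=> U p; pose x : 'rV[R]_#|ksubsets n k| := const_mx 1 *m orth_proj U.
have pE : p = ksubset_poly x by [].
have Hsym := token_H_sym k E w theta.
have H0 a b : a != b -> 0 <= token_H E w k theta a b.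
  move=> ab; rewrite !mxE (negPf ab) mulr0n mulr0 addr0 /=.
  by case: ifP => // /hw.
have N0 : (0 < #|ksubsets n k|)%N.
  by rewrite card_draws card_ord bin_gt0.
have [u [u0 u_ge0 uU]] := ex_top_eigenvector Hsym N0 H0.
have lX : good_limit k (coef_of x) by exact: token_top_projection.
have xE := kvector_coef_of x.
have x_ge0 a : 0 <= x 0 a.
  by rewrite -coef_ofE; apply: (good_limit_ge0 lX); apply: card_ksub.
have pos_entry (v : 'rV[R]_#|ksubsets n k|) : v != 0 -> (forall a, 0 <= v 0 a) ->
    exists a, 0 < v 0 a.
  by move=> /rV0Pn[a va] v0; exists a; rewrite lt_def va v0.
have x0 : x != 0.
  (* The pairing of the projection with [u] equals that of the all-ones vector, namely the positive
     sum of the entries of [u]. *)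
  have [a ua] := pos_entry u u0 u_ge0.
  apply/eqP => x0; have := dotv_orth_proj Hsym (const_mx 1) uU.
  rewrite -/U -/x x0 => /esym/eqP; rewrite (_ : dotv 0 u = 0); last first.
    by apply: big1 => b _; rewrite mxE mul0r.
  rewrite psumr_eq0 => [/allP/(_ a)|b _]; last by rewrite mxE mul1r.
  by rewrite mem_index_enum mxE mul1r (gt_eqF ua) => /(_ isT).
have colinear q v : perron_spans U q -> (v <= U)%MS -> v != 0 ->
    (forall a, 0 <= v 0 a) -> exists2 c, 0 < c & v = c *: q.
  move=> [qU q_ge0] vU v0 v_ge0.
  have /sub_rVP[c vE] : (v <= q)%MS by rewrite (eqmxP qU).
  have [a va] := pos_entry v v0 v_ge0.
  exists c => //; move: va; rewrite vE mxE; have := q_ge0 a.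
  rewrite le_eqVlt => /predU1P[<-|qa]; first by rewrite mulr0 ltxx.
  by rewrite pmulr_lgt0.
split.
- have [a xa] := pos_entry x x0 x_ge0.
  rewrite pE -xE; apply: (ksubset_poly_neq0 (card_ksub a)).
  by rewrite coef_ofE gt_eqF.
- by rewrite pE -xE; apply: good_limit_lorentzian.
move=> rU; split.
- exists u; split=> //; apply/andP; split=> //.
  by rewrite -(mxrank_leqif_sup uU) rank_rV u0 rU.
- move=> q q' hq [q'U q'_ge0]; apply: colinear => //; first by rewrite (eqmxP q'U).
  by rewrite -mxrank_eq0 (eqmxP q'U) rU.
(* Here [x] is a nonzero nonnegative vector of the line, so [q] is a positive multiple of it and
   inherits its approximations. *)
- move=> q hq; have [c c0 xq] := colinear q x hq (orth_proj_sub _ _) x0 x_ge0.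
  have -> : q = kvector k (fun T => c^-1 * coef_of x T).
    apply/rowP => a; rewrite mxE coef_ofE xq mxE mulKf ?gt_eqF //.
  by apply: good_limit_lorentzian => //; apply: good_limit_scale; rewrite ?invr_gt0.
Qed.
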